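(* Let $K_\Omega>0$, $b>0$ and $R_J>1$. If $b<1$ then $$\Lambda=\frac1{K_\Omega+b}.$$
   Context: $\Omega\subset\mathbb{R}^N$ is a bounded connected domain with $C^{1,\alpha}$ boundary. The kernel $J\colon\mathbb{R}^N\to\mathbb{R}$ is radially symmetric, nonnegative, continuous, compactly supported, with $J(0)>0$ and $\int_{\mathbb{R}^N}J(x)\,dx=1$. Let $R_J=\inf\{R: J(x)=0 \text{ in } \mathbb{R}^N\setminus B(0,R)\}\in(0,\infty)$ and assume $J(x)>0$ for $|x|<R_J$. Functions in $W^{1,\infty}_0(\Omega)$ are extended by $0$ to $\mathbb{R}^N\setminus\Omega$; $[u]_J=\sup\{|u(x)-u(y)|: x,y\in\mathbb{R}^N,\ x-y\in\operatorname{supp}(J)\}$ and $$\Lambda=\inf\left\{\frac{\max\{\|\nabla u\|_\infty,[u]_J\}}{\|u\|_\infty}: u\in W^{1,\infty}_0(\Omega)\setminus\{0\}\right\}.$$ The inradius is $R_\Omega=\max\{\operatorname{dist}(x,\partial\Omega): x\in\overline{\Omega}\}$, and $K_\Omega\in\mathbb{N}\cup\{0\}$, $b\in[0,R_J)$ are the quotient and remainder defined by $R_\Omega=K_\Omega R_J+b$. *)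

(* Defs.v *)
From HB Require Import structures.
From mathcomp Require Import all_boot all_order all_algebra.
From mathcomp Require Import all_classical all_reals all_analysis.

Set Implicit Arguments.
Unset Strict Implicit.
Unset Printing Implicit Defensive.

Import Order.TTheory GRing.Theory Num.Theory.
Import numFieldNormedType.Exports.

Local Open Scope classical_set_scope.
Local Open Scope ring_scope.

(* The norm and the balls that the library puts on 'rV[R]_n are those of the
   sup norm. They are used below only for the topology; all distances are
   Euclidean and go through enorm. *)

Definition rV_display : measure_display.
Proof. exact: default_measure_display. Qed.

(* Product sigma-algebra on R^n, generated by the coordinates; it is also the
   Borel sigma-algebra. *)
Section measurable_rV.
Context (R : realType) (n : nat).

Let coors : 'I_n -> 'rV[R]_n -> measurableTypeR R := fun i x => x ord0 i.

Let rV_set0 : g_sigma_preimage coors set0.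
Proof. exact: sigma_algebra0. Qed.

Let rV_setC A : g_sigma_preimage coors A -> g_sigma_preimage coors (~` A).
Proof. exact: sigma_algebraC. Qed.

Let rV_bigcup (F : (set 'rV[R]_n)^nat) :
  (forall i, g_sigma_preimage coors (F i)) ->
  g_sigma_preimage coors (\bigcup_i (F i)).
Proof. exact: sigma_algebra_bigcup. Qed.

HB.instance Definition _ := @isMeasurable.Build
  rV_display 'rV[R]_n (g_sigma_preimage coors)
  rV_set0 rV_setC rV_bigcup.

End measurable_rV.

Section lebesgue_rV.
Context (R : realType).

Definition cons_rV n (p : measurableTypeR R * 'rV[R]_n) : 'rV[R]_n.+1 :=
  \row_i oapp (p.2 ord0) p.1 (unlift ord0 i).

Lemma measurable_fun_rVP d (T : measurableType d) n (f : T -> 'rV[R]_n) :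
  (forall i, measurable_fun [set: T]
     ((fun t => f t ord0 i) : T -> measurableTypeR R)) ->
  measurable_fun [set: T] f.
Proof.
move=> mf.
suff : g_sigma_preimage (fun i t => f t ord0 i : measurableTypeR R) `<=` measurable.
  move=> H _ A mA; rewrite setTI; apply: H.
  have := @g_sigma_preimage_comp _ (measurableTypeR R) n _
     (fun i (x : 'rV[R]_n) => x ord0 i) _ f.
  rewrite /comp => ->; exists A => //; exact: setTI.
apply: smallest_sub; first exact: sigma_algebra_measurable.
case: n => [|n] in f mf *; first by rewrite big_ord0.
rewrite -bigcup_mkord_ord; apply: bigcup_sub => i Ii.
by move=> A [B mB <-]; exact: mf.
Qed.

Lemma measurable_coord n (i : 'I_n) :
  measurable_fun [set: 'rV[R]_n]
    ((fun x => x ord0 i) : 'rV[R]_n -> measurableTypeR R).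
Proof.
move=> _ Y mY; rewrite setTI; apply: sub_sigma_algebra => /=.
rewrite -bigcup_seq/=; exists i => /=; first by rewrite mem_index_enum.
by exists Y => //; rewrite setTI.
Qed.

Lemma measurable_cons_rV n : measurable_fun setT (@cons_rV n).
Proof.
apply: measurable_fun_rVP => i; rewrite /cons_rV.
case: (unliftP ord0 i) => [j|] ->.
  rewrite (_ : (fun _ => _) = (fun x : 'rV[R]_n => x ord0 j) \o snd).
    by apply: measurableT_comp => //; exact: measurable_coord.
  by apply/funext => t /=; rewrite mxE liftK.
rewrite (_ : (fun _ => _) = fst) //.
by apply/funext => t /=; rewrite mxE unlift_none.
Qed.

Definition uncons_rV n (x : 'rV[R]_n.+1) : measurableTypeR R * 'rV[R]_n :=
  (x ord0 ord0, \row_j x ord0 (lift ord0 j)).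

Lemma cons_rVK n : cancel (@cons_rV n) (@uncons_rV n).
Proof.
move=> [a v]; rewrite /uncons_rV /cons_rV mxE unlift_none /=; congr pair.
by apply/rowP => j; rewrite !mxE liftK.
Qed.

Lemma measurable_uncons_rV n : measurable_fun setT (@uncons_rV n).
Proof.
apply/measurable_fun_pairP; split; first exact: measurable_coord.
apply: measurable_fun_rVP => i.
rewrite (_ : (fun _ => _) = (fun x : 'rV[R]_n.+1 => x ord0 (lift ord0 i))).
  exact: measurable_coord.
by apply/funext => t /=; rewrite mxE.
Qed.

Section lebesgue_rV_succ.
Context (n : nat) (m : SigmaFiniteMeasure.type 'rV[R]_n R).

Definition lebesgue_rV_succ : set 'rV[R]_n.+1 -> \bar R :=
  pushforward (@lebesgue_measure R \x m)%E (@cons_rV n).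

Let pm : {measure set 'rV[R]_n.+1 -> \bar R} :=
  measure_function_pushforward__canonical__measure_function_Measure
    (@lebesgue_measure R \x m)%E (@measurable_cons_rV n).

Let succ0 : lebesgue_rV_succ set0 = 0%E.
Proof. exact: (measure0 pm). Qed.

Let succ_ge0 A : (0 <= lebesgue_rV_succ A)%E.
Proof. exact: (measure_ge0 pm). Qed.

Let succ_sigma_additive : semi_sigma_additive lebesgue_rV_succ.
Proof. exact: (@measure_semi_sigma_additive _ _ _ pm). Qed.

HB.instance Definition _ := isMeasure.Build _ _ _ lebesgue_rV_succ
  succ0 succ_ge0 succ_sigma_additive.

Let succ_sigma_finite : sigma_finite setT lebesgue_rV_succ.
Proof.
have /sigma_finiteP[F [TF ndF Foo]] := sigma_finiteT (@lebesgue_measure R).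
have /sigma_finiteP[G [TG ndG Goo]] := sigma_finiteT m.
exists (fun i => @uncons_rV n @^-1` (F i `*` G i)) => [|i].
  rewrite -preimage_bigcup -(preimage_setT (@uncons_rV n)); congr (_ @^-1` _).
  rewrite -setXTT TF TG; apply/seteqP; split => -[x y].
    move=> [/= [k _ Fkx] [l _ Gly]]; exists (maxn k l) => //; split.
    - by move: x Fkx; exact/subsetPset/ndF/leq_maxl.
    - by move: y Gly; exact/subsetPset/ndG/leq_maxr.
  by move=> [k _ []/= ? ?]; split; exists k.
have [mF Fi] := Foo i; have [mG Gi] := Goo i; split.
  rewrite -[X in measurable X]setTI; apply: measurable_uncons_rV => //.
  exact: measurableX.
rewrite /lebesgue_rV_succ /pushforward -comp_preimage.
rewrite (_ : _ \o _ = id) ?preimage_id; last first.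
  by apply/funext => x /=; rewrite cons_rVK.
by rewrite product_measure1E// lte_mul_pinfty// ge0_fin_numE.
Qed.

HB.instance Definition _ := @Measure_isSigmaFinite.Build _ _ _ lebesgue_rV_succ
  succ_sigma_finite.

End lebesgue_rV_succ.

Fixpoint lebesgue_rV n : SigmaFiniteMeasure.type 'rV[R]_n R :=
  if n is n'.+1 then lebesgue_rV_succ (lebesgue_rV n') else \d_(0 : 'rV[R]_0).

Lemma lebesgue_rV_box n (A : 'I_n -> set R) :
  (forall i, measurable (A i : set (measurableTypeR R))) ->
  lebesgue_rV n [set x | forall i, A i (x ord0 i)] =
  (\prod_(i < n) @lebesgue_measure R (A i))%E.
Proof.
elim: n A => [|n IH] A mA.
  by rewrite big_ord0 /= diracE mem_set//= => -[].
rewrite big_ord_recl /= /lebesgue_rV_succ /pushforward.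
pose B := [set x : 'rV[R]_n | forall i, A (lift ord0 i) (x ord0 i)].
have mB : measurable B.
  rewrite (_ : B = \bigcap_(i in [set: 'I_n])
    ((fun x : 'rV[R]_n => x ord0 i : measurableTypeR R) @^-1` A (lift ord0 i))).
    apply: fin_bigcap_measurable => // i _.
    by rewrite -[X in measurable X]setTI; apply: measurable_coord => //; exact: mA.
  by apply/seteqP; split => x /= H i; [move=> _|]; exact: H.
rewrite -(IH (fun i => A (lift ord0 i))) -/B; last by move=> i; exact: mA.
rewrite -product_measure1E//.
congr (_ _); apply/seteqP; split => -[a v] /=.
  move=> H; split => [|i] /=; first by have := H ord0; rewrite mxE unlift_none.
  by have := H (lift ord0 i); rewrite mxE liftK.
by move=> [/= Ha Hv] i; rewrite mxE; case: (unliftP ord0 i) => [j|] ->.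
Qed.

End lebesgue_rV.

Section euclidean.
Context (R : realType).

Definition enorm n (x : 'rV[R]_n) : R := Num.sqrt (\sum_i x ord0 i ^+ 2).

Definition bd n (A : set 'rV[R]_n) : set 'rV[R]_n := closure A `\` interior A.

Definition edist_to n (A : set 'rV[R]_n) (x : 'rV[R]_n) : R :=
  inf [set enorm (x - y) | y in A].

Definition inradius n (Omega : set 'rV[R]_n) : R :=
  sup [set edist_to (bd Omega) x | x in closure Omega].

Definition supp n (f : 'rV[R]_n -> R) : set 'rV[R]_n :=
  closure [set x | f x != 0].

Definition partial n (i : 'I_n) (f : 'rV[R]_n -> R) : 'rV[R]_n -> R :=
  'D_(delta_mx ord0 i) f.

Definition partials n (s : seq 'I_n) (f : 'rV[R]_n -> R) : 'rV[R]_n -> R :=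
  foldr (@partial n) f s.

Definition smooth n (f : 'rV[R]_n -> R) : Prop := forall s : seq 'I_n,
  continuous (partials s f) /\
  forall i x, derivable (partials s f) x (delta_mx ord0 i).

(* C_c^infty(Omega), with functions already extended by 0 *)
Definition test_function n (Omega : set 'rV[R]_n) (phi : 'rV[R]_n -> R) :
  Prop := [/\ smooth phi, compact (supp phi) & supp phi `<=` Omega].

(* For n = 0 this leaves gamma : R^0 -> R unconstrained, as it should. *)
Definition C1_holder n (alpha : R) (gamma : 'rV[R]_n -> R) : Prop :=
  (forall i y, derivable gamma y (delta_mx ord0 i)) /\
  exists C : R, forall i y z,
    `|partial i gamma y - partial i gamma z| <= C * enorm (y - z) `^ alpha.

(* Near each boundary point, up to an orthogonal change of coordinates,
   Omega is the region above the graph of a C^{1,alpha} function of the last n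
   coordinates. Since gamma need only describe Omega in a ball, requiring it
   to be globally defined and globally Holder costs no generality (cut-off). *)
Definition C1_holder_boundary n (alpha : R) (Omega : set 'rV[R]_n.+1) : Prop :=
  forall x0, bd Omega x0 ->
  exists (r : R) (Q : 'M[R]_n.+1) (gamma : 'rV[R]_n -> R),
    [/\ 0 < r, Q *m Q^T = 1%:M, C1_holder alpha gamma &
      forall x, enorm (x - x0) < r ->
        let y := x *m Q in
        Omega x <-> gamma (\row_j y ord0 (lift ord0 j)) < y ord0 ord0].

End euclidean.

Section sobolev.
Context (R : realType) (n : nat).
Implicit Types (Omega : set 'rV[R]_n) (u J : 'rV[R]_n -> R)
  (g : 'rV[R]_n -> 'rV[R]_n).
Local Notation leb := (@lebesgue_rV R n).

Definition Linf Omega u : \bar R := ('N[leb]_(+oo)[EFin \o patch (fun=> 0%R) Omega u])%E.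

Definition weak_gradient Omega u g : Prop :=
  forall phi, test_function Omega phi -> forall i : 'I_n,
    (\int[leb]_(x in Omega) (u x * partial i phi x)%:E =
     - \int[leb]_(x in Omega) (g x ord0 i * phi x)%:E)%E.

(* u is in W^{1,oo}(Omega), with weak gradient g (unique up to null sets) *)
Definition W1oo Omega u g : Prop :=
  [/\ measurable_fun Omega u, measurable_fun Omega g,
      (Linf Omega u < +oo)%E, (Linf Omega (fun x => enorm (g x)) < +oo)%E &
      weak_gradient Omega u g].

(* W^{1,oo}_0(Omega) is the space of u in W^{1,oo}(Omega) vanishing on the
   boundary. Such a class has exactly one representative whose extension by 0
   is continuous on R^n; u is that representative, already extended. *)
Definition W1oo0 Omega u g : Prop :=
  [/\ W1oo Omega u g, continuous u & forall x, ~ Omega x -> u x = 0].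

Definition jump_seminorm J u : R :=
  sup [set r | exists x y, supp J (x - y) /\ r = `|u x - u y|].

Definition jump_radius J : R :=
  inf [set r | forall x, ~ (enorm x < r) -> J x = 0].

Definition Lambda Omega J : R :=
  inf [set l | exists u g, [/\ W1oo0 Omega u g, exists x, u x != 0 &
    l = Num.max (fine (Linf Omega (fun x => enorm (g x)))) (jump_seminorm J u)
        / fine (Linf Omega u)]].

End sobolev.

(* Main.v *)
Require Import Defs.
From HB Require Import structures.
From mathcomp Require Import all_boot all_order all_algebra.
From mathcomp Require Import all_classical all_reals all_analysis.
From mathcomp Require Import measurable_realfun ess_sup_inf ring lra.

Set Implicit Arguments.
Unset Strict Implicit.
Unset Printing Implicit Defensive.

Import Order.TTheory GRing.Theory Num.Theory.
Import numFieldNormedType.Exports.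

Local Open Scope classical_set_scope.
Local Open Scope ring_scope.

(** Write [M] for the larger of the gradient norm and the jump seminorm of a
competitor [u], [r] for the jump radius, so that the inradius is [K r + b].

Lower bound. From a point [x] of the domain walk along a straight segment to
the boundary: some segment of length at most [K r + b + e] reaches it, and up
to its first exit point it stays inside. The first part of the walk is made
of [K] jumps shorter than [r], each of which changes [u] by at most the jump
seminorm; on the remaining part, of length at most [b + e], the function [u]
is Lipschitz with the gradient norm as constant; and [u] vanishes at the end.
Hence [|u x| <= K M + b M] ([normr_le_jump_grad]), which bounds every quotient
below by [1 / (K + b)].

Upper bound. Take a ball of radius [K r + b - e] inside the domain and a
radial function that climbs, as one moves inwards from the sphere, by [1] over
the first unit of length, then stays constant until the distance [r] is
reached, starts climbing again, and so on. As [1 < r] its slope is at most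
[1] and it grows by at most [1] over any length [r]; as [b < 1] the last climb
brings it to [K + b] up to a multiple of [e] at the centre
([radial_competitor]).

Two analytical facts carry this. First, a continuous function whose weak
gradient is bounded by [G] is [G]-Lipschitz along segments of the domain
([weak_gradient_lipschitz]): average the function against a smooth bump that
is carried along the segment; by the definition of the weak gradient the
derivative of the average is an average of the gradient, and one lets the bump
shrink. Second, the classical gradient of a [C^1] function is a weak gradient
([weak_gradient_C1]); this rests on the vanishing of the integral of a partial
derivative of a compactly supported function ([integral_partial_eq0]), proved
by induction on the dimension, with Fubini and the fundamental theorem of
calculus. To have a [C^1] competitor, the climbing profile is averaged over
intervals of length [e], and the distance to the centre is replaced by
[sqrt (|x - c|^2 + e^2)], which is smooth at [c]. *)

(** * Functions flat at the origin of the line *)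

Section flat.
Context (R : realType).
Implicit Types (p : {poly R}) (s : R).

(** Termwise, [y ^ i exp (- y) <= i!], since [y ^ i / i!] is a term of the
exponential series. *)
Lemma exp_beats_poly p :
  exists2 C : R, 0 <= C & forall y, 0 <= y -> `|p.[y] * expR (- y)| <= C.
Proof.
exists (\sum_(i < size p) `|p`_i| * i`!%:R).
  by apply: sumr_ge0 => i _; rewrite mulr_ge0.
move=> y y0; rewrite horner_coef mulr_suml.
apply: le_trans (ler_norm_sum _ _ _) _; apply: ler_sum => i _.
rewrite -mulrA normrM ler_wpM2l// ger0_norm; last first.
  by rewrite mulr_ge0 ?exprn_ge0 ?expR_ge0.
rewrite expRN ler_pdivrMr ?expR_gt0//.
case: i => -[|i] ilt /=; first by rewrite expr0 fact0 mul1r -expR0 ler_expR.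
have := expR_ge1Dxn i y0.
rewrite -ler_pdivrMl ?ltr0n ?fact_gt0// mulrC => H.
by apply: le_trans H; rewrite lerDr.
Qed.

(** For [p = 1] this is the standard smooth function [exp (- 1 / s)] glued to
[0]; allowing a polynomial in [1 / s] as a factor makes the family stable
under derivation. *)
Definition flat p s : R := if 0 < s then p.[s^-1] * expR (- s^-1) else 0.

(** With [y = 1 / s], the derivative of [p(y) exp (- y)] with respect to [s] is
[y ^ 2 (p - p')(y) exp (- y)]. *)
Definition flatD p : {poly R} := 'X^2 * (p - p^`()).

Lemma flat_le0 p s : s <= 0 -> flat p s = 0.
Proof. by rewrite /flat ltNge => ->. Qed.

Lemma flat1_gt0 s : 0 < s -> 0 < flat 1 s.
Proof. by move=> s0; rewrite /flat s0 hornerC mul1r expR_gt0. Qed.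

Lemma flat1_ge0 s : 0 <= flat 1 s.
Proof. by rewrite /flat; case: ifP => // _; rewrite hornerC mul1r expR_ge0. Qed.

Lemma flat_bounded p : exists2 C : R, 0 <= C & forall s, `|flat p s| <= C.
Proof.
have [C C0 HC] := exp_beats_poly p; exists C => // s; rewrite /flat.
case: ifP => s0; last by rewrite normr0.
by apply: HC; rewrite invr_ge0 ltW.
Qed.

(** Away from [0] this is the chain rule. At [0] the difference quotient is
[h] times the bounded function [flat ('X^2 * p)], so it tends to [0]. *)
Lemma is_derive_flat p s : is_derive s 1 (flat p) (flat (flatD p) s).
Proof.
have [s0|s0|->] := ltgtP s 0.
- rewrite (@flat_le0 (flatD p)); last exact: ltW.
  apply: (@near_eq_is_derive _ _ _ (cst 0)).
    by near=> z; rewrite flat_le0//; apply: ltW; near: z; exact: lt_nbhsl.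
- have sn0 : s != 0 by rewrite gt_eqF.
  rewrite {2}/flat s0.
  have E : \forall z \near s, p.[z^-1] * expR (- z^-1) = flat p z.
    by near=> z; rewrite /flat ifT//; near: z; exact: lt_nbhsr.
  apply: (near_eq_is_derive E).
  have dV : is_derive s 1 (fun z : R => z^-1) (- s ^- 2).
    apply: (is_derive_eq (is_deriveV (f := id) sn0 (is_derive_id s 1))).
    by rewrite /= scaler1.
  have dp : is_derive s 1 (fun z : R => p.[z^-1]) (- s ^- 2 * p^`().[s^-1]).
    apply: (is_derive_eq (is_derive1_comp (is_derive_poly _ _) dV)).
    by rewrite mulrC.
  have de : is_derive s 1 (fun z : R => expR (- z^-1)) (s ^- 2 * expR (- s^-1)).
    have dN : is_derive s 1 (fun z : R => - z^-1) (s ^- 2).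
      by apply: (is_derive_eq (is_deriveN dV)); rewrite opprK.
    apply: (is_derive_eq (is_derive1_comp (is_derive_expR _) dN)).
    by rewrite mulrC.
  apply: (is_derive_eq (is_deriveM dp de)).
  rewrite /flatD !hornerE /GRing.scale/=.
  by rewrite exprVn; ring.
- rewrite flat_le0//.
  have [C C0 HC] := exp_beats_poly ('X^2 * p).
  suff cv : (h^-1 *: (flat p (h *: 1 + 0) - flat p 0)) @[h --> 0^'] --> 0.
    by split; [apply/cvg_ex; exists 0; apply: cv|apply/cvg_lim => //; exact: cv].
  rewrite [in X in X @ _](flat_le0 p (lexx 0)).
  apply/cvgrPdist_le => e e0.
  near=> h.
  rewrite sub0r normrN subr0 addr0 /GRing.scale/= mulr1.
  have [h0|h0] := leP h 0; first by rewrite flat_le0// mulr0 normr0 ltW.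
  have := HC h^-1; rewrite invr_ge0 (ltW h0) => /(_ isT) Hh.
  have -> : h^-1 * flat p h = h * (('X^2 * p).[h^-1] * expR (- h^-1)).
    rewrite /flat h0 hornerM hornerXn expr2 !mulrA.
    by rewrite mulfV ?mul1r// gt_eqF.
  rewrite normrM gtr0_norm//.
  apply: (@le_trans _ _ (h * (C + 1))).
    by apply: ler_wpM2l; [exact: ltW|rewrite (le_trans Hh)// lerDl].
  rewrite -ler_pdivlMr ?ltr_wpDl//.
  apply: le_trans (ler_norm _) _.
  by near: h; apply: dnbhs0_le; rewrite divr_gt0// ltr_wpDl.
Unshelve. all: end_near. Qed.

Lemma derivable_flat p s : derivable (flat p) s 1.
Proof. by have [] := is_derive_flat p s. Qed.

Lemma differentiable_flat p s : differentiable (flat p) s.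
Proof. exact/derivable1_diffP/derivable_flat. Qed.

End flat.

(** * Coordinates, directional derivatives and lines *)

Section coordinates.
Context (R : realType) (n : nat).
Implicit Types (x v : 'rV[R]_n) (f : 'rV[R]_n -> R).

Lemma rV_norm_leP x e : 0 <= e -> (`|x| <= e) <-> (forall i, `|x ord0 i| <= e).
Proof.
move=> e0; rewrite [`|x|]/Num.Def.normr/= mx_normrE; split.
  by move/bigmax_leP => [_ H] i; exact: (H (ord0, i)).
by move=> H; apply/bigmax_leP; split => // -[i j] _ /=; rewrite ord1.
Qed.

Lemma coord_le_norm x i : `|x ord0 i| <= `|x|.
Proof. by have /rV_norm_leP := lexx `|x|; apply. Qed.

Lemma rV_norm_ltP x e : 0 < e -> (`|x| < e) <-> (forall i, `|x ord0 i| < e).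
Proof.
move=> e0; split=> [H i|H]; first exact: le_lt_trans (coord_le_norm _ _) H.
rewrite [`|x|]/Num.Def.normr/= mx_normrE.
by apply/bigmax_ltP; split => // -[i j] _ /=; rewrite ord1.
Qed.

Lemma derive_sum_partial f x v : differentiable f x ->
  'D_v f x = \sum_i v ord0 i * partial i f x.
Proof.
move=> df; rewrite deriveE// [in LHS](row_sum_delta v) linear_sum.
by apply: eq_bigr => i _; rewrite linearZ -deriveE.
Qed.

(** A directional derivative is an ordinary derivative along a line; all the
mean value arguments below are made in this form. *)
Lemma is_derive_line f a v (t : R) : derivable f (a + t *: v) v ->
  is_derive t 1 (fun s : R => f (a + s *: v)) ('D_v f (a + t *: v)).
Proof.
have E : (fun h : R => h^-1 *:
      (((fun s : R => f (a + s *: v)) \o shift t) (h *: (1 : R)) - f (a + t *: v))) =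
    (fun h : R => h^-1 *: ((f \o shift (a + t *: v)) (h *: v) - f (a + t *: v))).
  apply/funext => h /=; congr (_ *: (f _ - _)).
  by rewrite scalerDl [_ *: 1]mulr1 addrCA.
by move=> df; split; rewrite /derivable /derive E.
Qed.

End coordinates.

(** * Smooth bump functions *)

Section flat_algebra.
Context (R : realType) (n : nat).
Implicit Types (f g : 'rV[R]_n -> R).

(** An algebra of functions that is stable under all partial derivatives.
Smoothness, which speaks of all iterated partial derivatives, thus follows
from the first-order properties shared by the members of the algebra. *)
Inductive flat_algebra : ('rV[R]_n -> R) -> Prop :=
| flat_algebra_cst c : flat_algebra (cst c)
| flat_algebra_coord p a c i :
    flat_algebra (fun x => flat p (a + c * x ord0 i))
| flat_algebraD f g : flat_algebra f -> flat_algebra g -> flat_algebra (f + g)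
| flat_algebraM f g : flat_algebra f -> flat_algebra g -> flat_algebra (f * g).

Lemma flat_algebra_differentiable f x : flat_algebra f -> differentiable f x.
Proof.
elim=> [c|p a c i|{}f g _ df _ dg|{}f g _ df _ dg].
- exact: differentiable_cst.
- apply: (differentiable_comp (f := fun x : 'rV[R]_n => a + c * x ord0 i : R)
    (g := flat p)).
    have -> : (fun z : 'rV[R]_n => a + c * z ord0 i) =
              cst a + c *: (fun z : 'rV[R]_n => z ord0 i) by [].
    apply: differentiableD; first exact: differentiable_cst.
    by apply: differentiableZ; exact: differentiable_coord.
  exact: differentiable_flat.
- exact: differentiableD.
- exact: differentiableM.
Qed.

Lemma flat_algebra_derivable f x v : flat_algebra f -> derivable f x v.
Proof. by move=> /flat_algebra_differentiable df; exact: diff_derivable. Qed.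

Lemma flat_algebra_continuous f : flat_algebra f -> continuous f.
Proof.
by move=> ff x; exact/differentiable_continuous/flat_algebra_differentiable.
Qed.

Lemma flat_algebra_bounded f : flat_algebra f -> exists C, forall x, `|f x| <= C.
Proof.
elim=> [c|p a c i|{}f g _ [C HC] _ [D HD]|{}f g _ [C HC] _ [D HD]].
- by exists `|c|.
- by have [C _ HC] := flat_bounded p; exists C.
- by exists (C + D) => x; rewrite (le_trans (ler_normD _ _))// lerD.
- by exists (C * D) => x; rewrite normrM ler_pM.
Qed.

Lemma partial_flat_coord (p : {poly R}) a c i j x :
  partial j (fun x : 'rV[R]_n => flat p (a + c * x ord0 i)) x =
  c * (i == j)%:R * flat (flatD p) (a + c * x ord0 i).
Proof.
rewrite /partial.
transitivity ('D_(c * (i == j)%:R) (flat p) (a + c * x ord0 i)).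
  pose F (z : 'rV[R]_n) := flat p (a + c * z ord0 i).
  have E : (fun h : R => h^-1 *: ((F \o shift x) (h *: delta_mx ord0 j) - F x)) =
     (fun h : R => h^-1 *: ((flat p \o shift (a + c * x ord0 i))
        (h *: (c * (i == j)%:R)) - flat p (a + c * x ord0 i))).
    apply/funext => h; rewrite /F /= !mxE eqxx/=.
    by rewrite mulrDr addrCA [_ *: (_ * _)]mulrCA.
  by rewrite /derive E.
rewrite -[X in 'D_X _ _]mulr1 deriveE; last exact: differentiable_flat.
rewrite -[_ * _ * 1]/(_ *: (1 : R^o)) linearZ -deriveE; last exact: differentiable_flat.
by have [_ ->] := is_derive_flat p (a + c * x ord0 i).
Qed.

Lemma flat_algebra_partial f j : flat_algebra f -> flat_algebra (partial j f).
Proof.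
elim=> [c|p a c i|{}f g ff Hf fg Hg|{}f g ff Hf fg Hg].
- rewrite (_ : partial _ _ = cst 0); first exact: flat_algebra_cst.
  by apply/funext => x; rewrite /partial derive_cst.
- rewrite (_ : partial _ _ = cst (c * (i == j)%:R) *
    (fun x : 'rV[R]_n => flat (flatD p) (a + c * x ord0 i))).
    by apply: flat_algebraM; [exact: flat_algebra_cst|exact: flat_algebra_coord].
  by apply/funext => x; rewrite partial_flat_coord.
- rewrite (_ : partial _ _ = partial j f + partial j g); first exact: flat_algebraD.
  apply/funext => x; rewrite /partial deriveD//; exact: flat_algebra_derivable.
- rewrite (_ : partial _ _ = f * partial j g + g * partial j f).
    by apply: flat_algebraD; exact: flat_algebraM.
  apply/funext => x; rewrite /partial deriveM//; exact: flat_algebra_derivable.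
Qed.

Lemma flat_algebra_smooth f : flat_algebra f -> smooth f.
Proof.
move=> ff s.
have {}ff : flat_algebra (partials s f).
  by elim: s => //= i s; exact: flat_algebra_partial.
split; first exact: flat_algebra_continuous.
by move=> i x; exact: flat_algebra_derivable.
Qed.

Lemma flat_algebra_prod I (r : seq I) (F : I -> 'rV[R]_n -> R) :
  (forall i, flat_algebra (F i)) -> flat_algebra (fun x => \prod_(i <- r) F i x).
Proof.
move=> FF; elim: r => [|i r IH].
  rewrite (_ : (fun _ => _) = cst 1); first exact: flat_algebra_cst.
  by apply/funext => x; rewrite big_nil.
rewrite (_ : (fun _ => _) = F i * (fun x => \prod_(i <- r) F i x)).
  exact: flat_algebraM.
by apply/funext => x; rewrite big_cons.
Qed.

End flat_algebra.

Section bump.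
Context (R : realType) (n : nat).
Implicit Types (c z : 'rV[R]_n) (d : R).

(** For [0 < d], a nonnegative smooth function that is positive exactly on the
open cube with centre [c] and half-side [d]. *)
Definition bump d c z : R :=
  \prod_i (flat 1 (d - (z - c) ord0 i) * flat 1 (d + (z - c) ord0 i)).

Lemma flat_algebra_bump d c : flat_algebra (bump d c).
Proof.
apply: flat_algebra_prod => i.
rewrite (_ : (fun _ => _) = (fun z : 'rV[R]_n => flat 1 (d + c ord0 i + (-1) * z ord0 i))
  * (fun z : 'rV[R]_n => flat 1 (d - c ord0 i + 1 * z ord0 i))).
  by apply: flat_algebraM; exact: flat_algebra_coord.
apply/funext => z; rewrite !mxE /=.
by congr (flat _ _ * flat _ _); ring.
Qed.

Lemma bump_shift d c z : bump d c z = bump d 0 (z - c).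
Proof. by rewrite /bump subr0. Qed.

Lemma bump_ge0 d c z : 0 <= bump d c z.
Proof. by apply: prodr_ge0 => i _; rewrite mulr_ge0// flat1_ge0. Qed.

Lemma bump_gt0 d c z : 0 < d -> `|z - c| < d -> 0 < bump d c z.
Proof.
move=> d0 /rV_norm_ltP -/(_ d0) H; apply: prodr_gt0 => i _.
have := H i; rewrite ltr_norml => /andP[H1 H2].
by rewrite mulr_gt0// flat1_gt0// ?subr_gt0// addrC -[d]opprK subr_gt0.
Qed.

Lemma bump_neq0 d c z : 0 < d -> bump d c z != 0 -> `|z - c| < d.
Proof.
move=> d0 /prodf_neq0 H; apply/rV_norm_ltP => // i.
have := H i isT; rewrite mulf_eq0 negb_or => /andP[H1 H2].
rewrite ltr_norml; apply/andP; split.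
  rewrite ltNge; apply: contra H2 => H2; rewrite flat_le0//.
  by rewrite addrC -[d]opprK subr_le0.
rewrite ltNge; apply: contra H1 => H1; rewrite flat_le0//.
by rewrite subr_le0.
Qed.

Lemma bump_test_function d c (Omega : set 'rV[R]_n) : 0 < d ->
  (forall z, `|z - c| <= d -> Omega z) -> test_function Omega (bump d c).
Proof.
move=> d0 H.
have sub : supp (bump d c) `<=` [set z | `|z - c| <= d].
  have E : [set z | `|z - c| <= d] = closed_ball c d.
    by rewrite closed_ballE//; apply/seteqP; split => z /=; rewrite /closed_ball_/= distrC.
  have /closure_id -> : closed [set z | `|z - c| <= d].
    by rewrite E; exact: closed_ball_closed.
  by apply: closure_subset => z /= /(bump_neq0 d0)/ltW.
split; first exact/flat_algebra_smooth/flat_algebra_bump.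
- apply: bounded_closed_compact; last exact: closed_closure.
  exists (`|c| + d); split; first exact: num_real.
  move=> M HM z /sub /= zc; apply: ltW; apply: le_lt_trans HM.
  by rewrite -[z](subrK c) (le_trans (ler_normD _ _))// addrC lerD.
- by move=> z /sub; exact: H.
Qed.

End bump.

(** * The measure of cubes, open sets and bounded sets *)

Section measure_rV.
Context (R : realType) (n : nat).
Implicit Types (c : 'rV[R]_n) (r : R) (A : set 'rV[R]_n).
Local Notation leb := (lebesgue_rV R n).

Definition cube c r : set 'rV[R]_n := [set x | `|x - c| < r].

Lemma cube_itv c r : 0 < r -> cube c r =
  [set x : 'rV[R]_n | forall i, [set` `](c ord0 i - r), (c ord0 i + r)[] (x ord0 i)].
Proof.
move=> r0; apply/seteqP; split => x /=.
  move=> /rV_norm_ltP -/(_ r0) H i; have := H i.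
  by rewrite !mxE /= in_itv/= ltr_distl.
move=> H; apply/rV_norm_ltP => // i; have := H i.
by rewrite !mxE /= in_itv/= ltr_distl.
Qed.

Lemma measurable_cube c r : 0 < r -> measurable (cube c r).
Proof.
move=> r0; rewrite cube_itv//.
rewrite (_ : mkset _ = \bigcap_(i in [set: 'I_n])
    ((fun x : 'rV[R]_n => x ord0 i : measurableTypeR R) @^-1`
      [set` `](c ord0 i - r), (c ord0 i + r)[])).
  apply: fin_bigcap_measurable => // i _.
  by rewrite -[X in measurable X]setTI; apply: measurable_coord.
by apply/seteqP; split => x /= H i; [move=> _|]; exact: H.
Qed.

Lemma lebesgue_cube c r : 0 < r ->
  leb (cube c r) = ((2 * r) ^+ n)%:E.
Proof.
move=> r0; rewrite cube_itv//.
rewrite (@lebesgue_rV_box R n (fun i => [set` `](c ord0 i - r), (c ord0 i + r)[])); last first.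
  by move=> i; exact: measurable_itv.
under eq_bigr do rewrite lebesgue_measure_itv/= lte_fin ltrD2l gtrN// -EFinB.
rewrite (eq_bigr (fun=> (2 * r)%:E)); last first.
  by move=> i _; congr _%:E; ring.
by rewrite prodEFin prodr_const card_ord.
Qed.

(** The sigma-algebra is generated by the coordinates, and an open set is a
countable union of cubes with rational centres. *)
Lemma open_measurable_rV A : open A -> measurable A.
Proof.
move=> oA.
pose q (t : 'rV[rat]_n * nat) : 'rV[R]_n := map_mx ratr t.1.
pose r (t : 'rV[rat]_n * nat) : R := t.2.+1%:R^-1.
have r0 t : 0 < r t by rewrite invr_gt0.
pose F t := if pselect (cube (q t) (r t) `<=` A)
  then cube (q t) (r t) else set0.
have -> : A = \bigcup_t F t.
  apply/seteqP; split => [x Ax|x [t _]]; last first.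
    by rewrite /F; case: pselect => // H; exact: H.
  have /nbhs_ballP[e /= e0 xeA] : nbhs x A by exact: open_nbhs_nbhs.
  have [k _ ke] : exists2 k : nat, True & k.+1%:R^-1 < e / 2.
    have := near_infty_natSinv_lt (PosNum (divr_gt0 e0 (ltr0n R 2))).
    by move=> [k _ /(_ k (leqnn _)) /= H]; exists k.
  have /choice[y Hy] i : exists y : rat, ratr y \in
      `](x ord0 i - k.+1%:R^-1), (x ord0 i + k.+1%:R^-1)[.
    by apply: rat_in_itvoo; rewrite ltrD2l gtrN// invr_gt0.
  have xq : `|x - q (\row_i y i, k)| < k.+1%:R^-1.
    apply/rV_norm_ltP; first by rewrite invr_gt0.
    by move=> i; rewrite !mxE/= distrC ltr_distl; have := Hy i; rewrite in_itv.
  exists (\row_i y i, k) => //; rewrite /F; case: pselect => //; apply.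
  move=> z zq; apply: xeA; rewrite -ball_normE /ball_/=.
  rewrite -(subrKA (q (\row_i y i, k))) (le_lt_trans (ler_normD _ _))//.
  rewrite (splitr e) ltrD//; first exact: lt_trans ke.
  by rewrite distrC; exact: lt_trans ke.
apply: countable_bigcupT_measurable => // t.
by rewrite /F; case: ifPn => _; [exact: measurable_cube|exact: measurable0].
Qed.

Lemma continuous_measurable_rV (f : 'rV[R]_n -> R) :
  continuous f -> measurable_fun [set: 'rV[R]_n] (f : 'rV[R]_n -> measurableTypeR R).
Proof.
move=> /continuousP cf; apply: (measurability (@RGenOInfty.G R)).
  exact: RGenOInfty.measurableE.
move=> _ [_ [a ->] <-]; rewrite setTI; apply: open_measurable_rV.
by apply: cf; exact: interval_open.
Qed.

Lemma bounded_lebesgue_fin A : measurable A -> bounded_set A -> (leb A < +oo)%E.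
Proof.
move=> mA [M [_ HM]].
have M0 : 0 < `|M| + 1 by rewrite ltr_wpDl.
apply: (@le_lt_trans _ _ (leb (cube 0 (`|M| + 1 + 1)))).
  apply: le_measure; rewrite ?inE//; first by apply: measurable_cube; rewrite addr_gt0.
  move=> x Ax; rewrite /cube/= subr0; apply: (@le_lt_trans _ _ (`|M| + 1)).
    by apply: HM => //; rewrite (le_lt_trans (ler_norm _))// ltrDl.
  by rewrite ltrDl.
by rewrite lebesgue_cube ?ltry// addr_gt0.
Qed.

Lemma open_lebesgue_gt0 A : open A -> A !=set0 -> (0 < leb A)%E.
Proof.
move=> oA [x Ax]; have /nbhs_ballP[e /= e0 xeA] : nbhs x A by exact: open_nbhs_nbhs.
apply: (@lt_le_trans _ _ (leb (cube x e))).
  by rewrite lebesgue_cube// lte_fin exprn_gt0// mulr_gt0.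
apply: le_measure; rewrite ?inE; [exact: measurable_cube|exact: open_measurable_rV|].
by move=> z xz; apply: xeA; rewrite -ball_normE /ball_/= distrC.
Qed.

Lemma lebesgue_setT_gt0 : (0 < leb [set: 'rV[R]_n])%E.
Proof. by apply: open_lebesgue_gt0; [exact: openT|exists 0]. Qed.

Lemma continuous_compact_support_bounded (f : 'rV[R]_n -> R) M : continuous f ->
  (forall x, M < `|x| -> f x = 0) -> exists2 C, 0 <= C & forall x, `|f x| <= C.
Proof.
move=> cf f0.
have cB : compact (closed_ball (0 : 'rV[R]_n) (`|M| + 1)).
  apply: bounded_closed_compact; last exact: closed_ball_closed.
  rewrite closed_ballE ?ltr_wpDl//.
  exists (`|M| + 1); split; first exact: num_real.
  move=> N HN z; rewrite /closed_ball_/= sub0r normrN => H.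
  by apply: ltW; apply: le_lt_trans HN.
have [C [_ HC]] := compact_bounded
  (@continuous_compact _ _ f _ (continuous_subspaceT cf) cB).
exists (`|C| + 1) => // x.
have [xM|xM] := leP `|x| M; last by rewrite f0// normr0.
apply: (HC (`|C| + 1)); first by rewrite (le_lt_trans (ler_norm _))// ltrDl.
exists x => //; rewrite closed_ballE ?ltr_wpDl// /closed_ball_/= sub0r normrN.
by rewrite (le_trans xM)// (le_trans (ler_norm _))// lerDl.
Qed.

Lemma integrable_bounded_support (f : 'rV[R]_n -> R) C M :
  measurable_fun [set: 'rV[R]_n] (f : 'rV[R]_n -> measurableTypeR R) ->
  (forall x, `|f x| <= C) -> (forall x, M < `|x| -> f x = 0) ->
  leb.-integrable setT (EFin \o f).
Proof.
move=> mf fC f0.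
pose B : set 'rV[R]_n := cube 0 (`|M| + 1).
have M0 : 0 < `|M| + 1 by rewrite ltr_wpDl.
have mB : measurable B by exact: measurable_cube.
have : leb.-integrable B (EFin \o f).
  apply: measurable_bounded_integrable => //.
  - by rewrite [X in (X < _)%E]lebesgue_cube// ltry.
  - exact: measurable_funTS.
  - exists C; split; first exact: num_real.
    by move=> N CN x _ /=; apply: le_trans (ltW CN).
move/(integrable_mkcond _ mB); congr (_.-integrable _ _).
apply/funext => x; rewrite /patch; case: ifPn => // /negP xB.
rewrite /= f0//; rewrite ltNge; apply/negP => xM; apply: xB.
rewrite inE /B /cube /= subr0 (le_lt_trans xM)// (le_lt_trans (ler_norm _))// ltrDl.
by [].
Qed.

End measure_rV.

(** * The integral of a partial derivative vanishes *)

Section integral_partial.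
Context (R : realType).

Lemma cons_rV_norm_sub n (a : R) (v w : 'rV[R]_n) :
  `|cons_rV (a, v) - cons_rV (a, w)| <= `|v - w|.
Proof.
apply/rV_norm_leP => // i; rewrite !mxE.
case: (unliftP ord0 i) => [j|] _ /=; last by rewrite subrr normr0.
by apply: le_trans (coord_le_norm _ j); rewrite !mxE.
Qed.

Lemma norm_le_cons_rV_tail n (a : R) (v : 'rV[R]_n) : `|v| <= `|cons_rV (a, v)|.
Proof.
apply/rV_norm_leP => // i; apply: le_trans (coord_le_norm _ (lift ord0 i)).
by rewrite mxE liftK.
Qed.

Lemma norm_le_cons_rV_head n (a : R) (v : 'rV[R]_n) : `|a| <= `|cons_rV (a, v)|.
Proof.
by apply: le_trans (coord_le_norm _ ord0); rewrite mxE unlift_none.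
Qed.

Lemma continuous_cons_rV n (a : R) : continuous (fun v : 'rV[R]_n => cons_rV (a, v)).
Proof.
move=> v; apply/(@cvgrPdist_le _ _ _ (nbhs v)) => e e0.
have H : nbhs v [set w : 'rV[R]_n | `|v - w| < e].
  by have := nbhsx_ballx v e e0; rewrite -ball_normE.
apply: (@filterS _ (nbhs v) _ _ _ _ H) => w /= /ltW; apply: le_trans.
exact: cons_rV_norm_sub.
Qed.

Lemma cons_rV_lift n (a h : R) (v : 'rV[R]_n) j :
  cons_rV (a, h *: delta_mx ord0 j + v) =
  h *: delta_mx ord0 (lift ord0 j) + cons_rV (a, v).
Proof.
apply/rowP => i; rewrite !mxE; case: (unliftP ord0 i) => [k|] -> /=.
  by rewrite !mxE (inj_eq lift_inj).
by rewrite mulr0 add0r.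
Qed.

(** Partial derivatives in all directions but the first are partial derivatives
of the slices, in one dimension less. *)
Lemma partial_cons_rV n (h : 'rV[R]_n.+1 -> R) j a v :
  partial (lift ord0 j) h (cons_rV (a, v)) =
    partial j (fun w => h (cons_rV (a, w))) v /\
  (derivable h (cons_rV (a, v)) (delta_mx ord0 (lift ord0 j)) ->
   derivable (fun w => h (cons_rV (a, w))) v (delta_mx ord0 j)).
Proof.
have E : (fun t : R => t^-1 *: ((h \o shift (cons_rV (a, v)))
      (t *: delta_mx ord0 (lift ord0 j)) - h (cons_rV (a, v)))) =
    (fun t : R => t^-1 *: (((fun w => h (cons_rV (a, w))) \o shift v)
      (t *: delta_mx ord0 j) - h (cons_rV (a, v)))).
  by apply/funext => t; rewrite /= cons_rV_lift.
by rewrite /partial /derive /derivable E.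
Qed.

Lemma cons_rV_ord0 n (a : R) (v : 'rV[R]_n) :
  cons_rV (a, v) = cons_rV (0, v) + a *: delta_mx ord0 ord0.
Proof.
apply/rowP => i; rewrite !mxE; case: (unliftP ord0 i) => [k|] -> /=.
  by rewrite mulr0 addr0.
by rewrite mulr1 add0r.
Qed.

Lemma continuous_line n (a v : 'rV[R]_n) : continuous (fun t : R => a + t *: v).
Proof. by move=> t; apply: cvgD; [exact: cvg_cst|apply: cvgZr_tmp; exact: cvg_id]. Qed.

Lemma partial_support n (h : 'rV[R]_n -> R) i M :
  (forall x, M < `|x| -> h x = 0) -> forall x, M < `|x| -> partial i h x = 0.
Proof.
move=> h0 x xM; rewrite /partial -(derive_cst (0 : R) x (delta_mx ord0 i)).
apply: near_eq_derive; near=> z; apply: h0; near: z.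
by apply: (cvgr_gt `|x|) => //; exact: norm_continuous.
Unshelve. all: end_near. Qed.

Lemma integral_derive_eq0 (f df : R -> R) M :
  (forall t, is_derive t (1 : R) f (df t)) -> continuous df ->
  (forall t, M < `|t| -> f t = 0) -> (forall t, M < `|t| -> df t = 0) ->
  (\int[@lebesgue_measure R]_t (df t)%:E = 0)%E.
Proof.
move=> fdf cdf f0 df0.
pose N := `|M| + 1.
have N0 : 0 < N by rewrite ltr_wpDl.
have MN : M < N by rewrite (le_lt_trans (ler_norm _))// ltrDl.
(* f vanishes at both ends of this interval, and df outside it. *)
have E : (fun t => (df t)%:E) = (fun t => (df t)%:E) \_ `[-N, N].
  apply/funext => t; rewrite /patch; case: ifPn => // /negP tN.
  rewrite df0//; rewrite ltNge; apply/negP => tM; apply: tN.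
  by rewrite inE /= in_itv/= -ler_norml (le_trans tM)// ltW.
rewrite E -integral_mkcond (@continuous_FTC2 _ df f).
- by rewrite !f0 ?normrN ?gtr0_norm// subee.
- by rewrite gtrN.
- exact: continuous_subspaceT.
- have cf : continuous f.
    move=> t; apply: differentiable_continuous; apply/derivable1_diffP.
    by have [] := fdf t.
  split => [t _||].
  + by have [] := fdf t.
  + by apply: cvg_at_right_filter; exact: cf.
  + by apply: cvg_at_left_filter; exact: cf.
- by move=> t _; rewrite derive1E; have [_ ->] := fdf t.
Qed.

(** Induction on the dimension, splitting off the first coordinate with Fubini:
for the derivative in that coordinate, integrate it first and apply the
one-dimensional case; for any other one, integrate the slices first and apply
the induction hypothesis. *)
Lemma integral_partial_eq0 n (i : 'I_n) (h : 'rV[R]_n -> R) M :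
  (forall x, derivable h x (delta_mx ord0 i)) -> continuous (partial i h) ->
  (forall x, M < `|x| -> h x = 0) ->
  (\int[lebesgue_rV R n]_x (partial i h x)%:E = 0)%E.
Proof.
elim: n i h => [[]//|n IH] i h dh ch h0.
have ph0 := partial_support i h0.
have [C C0 hC] := continuous_compact_support_bounded ch ph0.
have mph := continuous_measurable_rV ch.
have iph := integrable_bounded_support mph hC ph0.
pose m1 : {sigma_finite_measure set _ -> \bar R} := @lebesgue_measure R.
pose m2 : {sigma_finite_measure set _ -> \bar R} := lebesgue_rV R n.
have mE : measurable_fun setT (EFin \o partial i h) by exact/measurable_EFinP.
have mG := measurableT_comp mE (@measurable_cons_rV R n).
have iG : (m1 \x m2)%E.-integrable setT ((EFin \o partial i h) \o @cons_rV R n).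
  apply/integrableP; split => //.
  have /integrableP[_] := iph; congr (_ < _)%E.
  apply: (ge0_integral_pushforward (@measurable_cons_rV R n) (m1 \x m2)%E) => //.
  exact: measurableT_comp.
transitivity (\int[(m1 \x m2)%E]_p ((EFin \o partial i h) \o @cons_rV R n) p)%E.
  exact: (integral_pushforward (@measurable_cons_rV R n) (mu := (m1 \x m2)%E)).
rewrite -integral12_prod_meas1//.
case: (unliftP ord0 i) => [j|] Ei; last first.
  rewrite [LHS](Fubini iG) integral0_eq// => y _.
  apply: (@integral_derive_eq0 (fun t => h (cons_rV (t, y))) _ M).
  - move=> t; rewrite cons_rV_ord0 /partial Ei.
    under eq_fun do rewrite cons_rV_ord0.
    by apply: is_derive_line; rewrite -Ei.
  - under eq_fun do rewrite cons_rV_ord0.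
    by move=> t; apply: continuous_comp; [exact: continuous_line|exact: ch].
  - by move=> t tM; apply: h0; rewrite (lt_le_trans tM)// norm_le_cons_rV_head.
  - by move=> t tM; apply: ph0; rewrite (lt_le_trans tM)// norm_le_cons_rV_head.
rewrite integral0_eq// => x _; rewrite /fubini_F.
have E y : partial i h (cons_rV (x, y)) = partial j (fun v => h (cons_rV (x, v))) y.
  by rewrite Ei; have [] := partial_cons_rV h j x y.
under eq_integral do rewrite /= E.
apply: IH.
- by move=> y; have [_] := partial_cons_rV h j x y; apply; rewrite -Ei; exact: dh.
- rewrite -(funext E) => y.
  by apply: continuous_comp; [exact: continuous_cons_rV|exact: ch].
- by move=> y yM; apply: h0; rewrite (lt_le_trans yM)// norm_le_cons_rV_tail.
Qed.

End integral_partial.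

(** * The essential supremum of a continuous function *)

Section Linf.
Context (R : realType) (n : nat).
Implicit Types (Omega : set 'rV[R]_n) (u : 'rV[R]_n -> R).
Local Notation leb := (lebesgue_rV R n).

Lemma LinfE Omega u :
  Linf Omega u = ess_sup leb (abse \o (EFin \o patch (fun=> 0) Omega u)).
Proof. by rewrite /Linf unlock lebesgue_setT_gt0. Qed.

Lemma Linf_ge0 Omega u : (0 <= Linf Omega u)%E.
Proof. exact: Lnorm_ge0. Qed.

Lemma Linf_le Omega u C : 0 <= C -> (forall x, Omega x -> `|u x| <= C) ->
  (Linf Omega u <= C%:E)%E.
Proof.
move=> C0 uC; rewrite LinfE; apply/ess_supP; apply/aeW => x.
rewrite /= /patch lee_fin; case: ifPn => [|_]; last by rewrite normr0.
by rewrite inE; exact: uC.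
Qed.

Lemma fine_Linf_le Omega u C : 0 <= C -> (forall x, Omega x -> `|u x| <= C) ->
  fine (Linf Omega u) <= C.
Proof.
move=> C0 uC; rewrite -lee_fin fineK ?Linf_le//.
by rewrite ge0_fin_numE ?Linf_ge0// (le_lt_trans (Linf_le C0 uC))// ltry.
Qed.

Lemma Linf_ae Omega u : (Linf Omega u < +oo)%E ->
  {ae leb, forall x, Omega x -> `|u x| <= fine (Linf Omega u)}.
Proof.
move=> fu; have := ess_sup_ge leb (abse \o (EFin \o patch (fun=> 0) Omega u)).
rewrite -LinfE; apply: filterS => x; rewrite /= /patch => ux Ox.
rewrite mem_set// in ux.
by rewrite -lee_fin fineK// ge0_fin_numE ?Linf_ge0.
Qed.

(** The set where the bound fails is open and null, hence empty. *)
Lemma normr_le_Linf Omega u x : open Omega -> continuous u ->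
  (Linf Omega u < +oo)%E -> Omega x -> `|u x| <= fine (Linf Omega u).
Proof.
move=> oO cu fu Ox; rewrite leNgt; apply/negP => ux.
have [N [mN N0 HN]] := Linf_ae fu.
pose A := Omega `&` [set z | fine (Linf Omega u) < `|u z|].
have oA : open A.
  apply: openI => //; rewrite (_ : [set _ | _] =
    (fun z => `|u z|) @^-1` `](fine (Linf Omega u)), +oo[).
    apply: open_comp; last exact: interval_open.
    by move=> z _; apply: continuous_comp; [exact: cu|exact: norm_continuous].
  by apply/seteqP; split => z /=; rewrite in_itv/= andbT.
have : (0 < leb A)%E by apply: open_lebesgue_gt0 => //; exists x.
apply/negP; rewrite -leNgt -[leRHS]N0.
apply: le_measure; rewrite ?inE//; first exact: open_measurable_rV.
move=> z [Oz uz]; apply: HN => /= /(_ Oz).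
by rewrite leNgt uz.
Qed.

End Linf.

(** * The Euclidean norm *)

Section euclidean_norm.
Context (R : realType) (n : nat).
Implicit Types (x y v : 'rV[R]_n).

Lemma enorm_ge0 x : 0 <= enorm x.
Proof. exact: sqrtr_ge0. Qed.

Lemma sumsq_ge0 x : 0 <= \sum_i x ord0 i ^+ 2.
Proof. by apply: sumr_ge0 => i _; exact: sqr_ge0. Qed.

Lemma enorm_sqr x : enorm x ^+ 2 = \sum_i x ord0 i ^+ 2.
Proof. by rewrite sqr_sqrtr// sumsq_ge0. Qed.

Lemma enormZ (a : R) x : enorm (a *: x) = `|a| * enorm x.
Proof.
rewrite /enorm -sqrtr_sqr -sqrtrM ?sqr_ge0//; congr Num.sqrt.
by rewrite mulr_sumr; apply: eq_bigr => i _; rewrite mxE exprMn.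
Qed.

Lemma enormN x : enorm (- x) = enorm x.
Proof. by rewrite -scaleN1r enormZ normrN normr1 mul1r. Qed.

Lemma enorm0 : enorm (0 : 'rV[R]_n) = 0.
Proof. by rewrite -(scale0r 0) enormZ normr0 mul0r. Qed.

Lemma coord_le_enorm x i : `|x ord0 i| <= enorm x.
Proof.
rewrite -sqrtr_sqr ler_wsqrtr// (bigD1 i)//= lerDl.
by apply: sumr_ge0 => j _; exact: sqr_ge0.
Qed.

Lemma norm_le_enorm x : `|x| <= enorm x.
Proof. by apply/rV_norm_leP; [exact: enorm_ge0|exact: coord_le_enorm]. Qed.

Lemma enorm_le_norm x : enorm x <= n%:R * `|x|.
Proof.
rewrite -[leRHS]ger0_norm ?mulr_ge0// -sqrtr_sqr.
rewrite ler_wsqrtr// exprMn -natrX.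
apply: (@le_trans _ _ (\sum_(i < n) `|x| ^+ 2)).
  apply: ler_sum => i _; rewrite -real_normK ?num_real//.
  by rewrite ler_pXn2r ?nnegrE// coord_le_norm.
rewrite sumr_const card_ord -[leLHS]mulr_natl.
apply: ler_wpM2r; rewrite ?sqr_ge0// ler_nat.
by case: (n) => // m; rewrite -mulnn leq_pmulr.
Qed.

(** Cauchy-Schwarz. With [A], [B] the squared norms of [x], [y] and [c] their
inner product, [B (A B - c ^ 2)] is the squared norm of [B x - c y]. *)
Lemma dot_le_enorm x y : `|\sum_i x ord0 i * y ord0 i| <= enorm x * enorm y.
Proof.
set c := \sum_i _.
have A0 := sumsq_ge0 x; have B0 := sumsq_ge0 y.
rewrite -sqrtr_sqr /enorm -sqrtrM// ler_wsqrtr//.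
set A := \sum_i x _ _ ^+ 2 in A0 *; set B := \sum_i y _ _ ^+ 2 in B0 *.
(* B may vanish, hence the separate case below. *)
have H : 0 <= B * (A * B - c ^+ 2).
  have -> : B * (A * B - c ^+ 2) = \sum_i (B * x ord0 i - c * y ord0 i) ^+ 2.
    under eq_bigr do rewrite sqrrB !exprMn -mulr_natl.
    rewrite big_split/= sumrB -!mulr_sumr -/A -/B.
    rewrite (eq_bigr (fun i => (B * c) * (x ord0 i * y ord0 i))); last first.
      by move=> i _; ring.
    by rewrite -mulr_sumr -/c; ring.
  by apply: sumr_ge0 => i _; exact: sqr_ge0.
move: B0; rewrite le_eqVlt => /predU1P[B0|B0]; last first.
  by rewrite -subr_ge0 -(pmulr_rge0 _ B0).
have y0 i : y ord0 i = 0.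
  move/eqP: (esym B0); rewrite psumr_eq0; last by move=> j _; exact: sqr_ge0.
  by move=> /allP/(_ i); rewrite mem_index_enum sqrf_eq0 => /(_ isT)/eqP.
rewrite -B0 mulr0 /c big1 ?expr0n//= => i _.
by rewrite y0 mulr0.
Qed.

Lemma enormD x y : enorm (x + y) <= enorm x + enorm y.
Proof.
rewrite -(@ler_pXn2r _ 2)// ?nnegrE ?addr_ge0 ?enorm_ge0//.
rewrite sqrrD !enorm_sqr.
under eq_bigr do rewrite mxE sqrrD.
rewrite big_split/= big_split/= lerD2r lerD2l sumrMnl lerMn2r/=.
exact: le_trans (ler_norm _) (dot_le_enorm _ _).
Qed.

Lemma enorm_sub x y : `|enorm x - enorm y| <= enorm (x - y).
Proof.
have H (a b : 'rV[R]_n) : enorm a - enorm b <= enorm (a - b).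
  by rewrite lerBlDr -{1}(subrK b a) enormD.
by rewrite ler_norml H andbT lerNl opprB (le_trans (H _ _))// -enormN opprB.
Qed.

Lemma enorm_continuous : continuous (@enorm R n).
Proof.
move=> x; apply/(@cvgrPdist_le _ _ _ (nbhs x)) => e e0.
have d0 : 0 < e / n.+1%:R by rewrite divr_gt0.
have H : nbhs x [set w : 'rV[R]_n | `|x - w| < e / n.+1%:R].
  by have := nbhsx_ballx x _ d0; rewrite -ball_normE.
apply: (@filterS _ (nbhs x) _ _ _ _ H) => w /= /ltW xw.
apply: le_trans (enorm_sub _ _) _; apply: le_trans (enorm_le_norm _) _.
apply: (@le_trans _ _ (n.+1%:R * (e / n.+1%:R))).
  by apply: ler_pM => //; rewrite ler_nat.
by rewrite mulrC divfK ?pnatr_eq0.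
Qed.

End euclidean_norm.

(** * The gradient of a smooth function is a weak gradient *)

Section weak_gradient_facts.
Context (R : realType) (n : nat).
Local Notation leb := (lebesgue_rV R n).
Implicit Types (Omega : set 'rV[R]_n) (u : 'rV[R]_n -> R).

Lemma Rintegral_sum D I (r : seq I) (h : I -> 'rV[R]_n -> R) : measurable D ->
  (forall i, leb.-integrable D (EFin \o h i)) ->
  (\int[leb]_(x in D) (\sum_(i <- r) h i x) = \sum_(i <- r) \int[leb]_(x in D) h i x)%R.
Proof.
move=> mD ih; rewrite /Rintegral.
under eq_integral do rewrite -sumEFin.
rewrite (integral_sum mD ih) sum_fine//.
by move=> i _; apply: integrable_fin_num => //; exact: ih.
Qed.

Lemma integral_support Omega (F : 'rV[R]_n -> R) : (forall x, ~ Omega x -> F x = 0) ->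
  (\int[leb]_(x in Omega) (F x)%:E = \int[leb]_x (F x)%:E)%E.
Proof.
move=> F0; rewrite integral_mkcond; apply: eq_integral => x _.
rewrite /patch; case: ifPn => // /negP xO; rewrite F0// => Ox.
by apply: xO; rewrite inE.
Qed.

(** The product [u * phi] has compact support, so its [i]-th partial derivative
has integral [0]; expand it with Leibniz' rule. *)
Lemma weak_gradient_C1 Omega u : measurable Omega -> continuous u ->
  (forall i x, derivable u x (delta_mx ord0 i)) ->
  (forall i, continuous (partial i u)) ->
  weak_gradient Omega u (fun x => \row_i partial i u x).
Proof.
move=> mO cu du cdu phi [sphi cphi subphi] i.
have [phic phid] := sphi [::]; have [dphic _] := sphi [:: i].
have [M [_ HM]] := compact_bounded cphi.
pose N := `|M| + 1.
have MN : M < N by rewrite (le_lt_trans (ler_norm _))// ltrDl.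
have phi0 x : N < `|x| -> phi x = 0.
  move=> xN; apply/eqP; apply/negPn/negP => px.
  have /(HM _ MN) : supp phi x by exact: subset_closure.
  by rewrite /= leNgt xN.
have dphi0 := partial_support i phi0.
have dphi_out x : ~ supp phi x -> partial i phi x = 0.
  move=> xs; rewrite /partial -(derive_cst (0 : R) x (delta_mx ord0 i)).
  apply: near_eq_derive.
  have := open_nbhs_nbhs (conj (closed_openC (@closed_closure _ [set x | phi x != 0])) xs).
  apply: filterS => z zs; apply/eqP/negPn/negP => pz; apply: zs.
  exact: subset_closure.
have phi_out x : ~ supp phi x -> phi x = 0.
  move=> xs; apply/eqP/negPn/negP => pz; apply: xs.
  exact: subset_closure.
have c1 : continuous (fun x => u x * partial i phi x).
  by move=> x; apply: (@cvgM _ _ (nbhs x)); [exact: cu|exact: dphic].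
have c2 : continuous (fun x => partial i u x * phi x).
  by move=> x; apply: (@cvgM _ _ (nbhs x)); [exact: cdu|exact: phic].
have z1 x : N < `|x| -> u x * partial i phi x = 0 by move=> /dphi0 ->; rewrite mulr0.
have z2 x : N < `|x| -> partial i u x * phi x = 0 by move=> /phi0 ->; rewrite mulr0.
have [C1 _ HC1] := continuous_compact_support_bounded c1 z1.
have [C2 _ HC2] := continuous_compact_support_bounded c2 z2.
have i1 := integrable_bounded_support (continuous_measurable_rV c1) HC1 z1.
have i2 := integrable_bounded_support (continuous_measurable_rV c2) HC2 z2.
under [in RHS]eq_integral do rewrite mxE.
rewrite (integral_support (F := fun x => u x * partial i phi x)); last first.
  by move=> x xO; rewrite dphi_out ?mulr0// => /subphi.
rewrite (integral_support (F := fun x => partial i u x * phi x)); last first.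
  by move=> x xO; rewrite phi_out ?mulr0// => /subphi.
have E x : partial i (u * phi) x = u x * partial i phi x + partial i u x * phi x.
  rewrite /partial deriveM//; congr (_ + _).
  by rewrite -[LHS]/(phi x * _) mulrC.
have : (\int[leb]_x (partial i (u * phi) x)%:E = 0)%E.
  apply: (@integral_partial_eq0 _ _ _ _ N).
  - by move=> x; apply: derivableM.
  - by rewrite (funext E) => x; apply: (@cvgD _ _ _ (nbhs x)); [exact: c1|exact: c2].
  - by move=> x /phi0; rewrite fctE => ->; rewrite mulr0.
under eq_integral do rewrite E EFinD.
rewrite integralD// => ab0.
have fb : (\int[leb]_x (partial i u x * phi x)%:E)%E \is a fin_num.
  exact: integrable_fin_num i2.
by rewrite -[LHS]adde0 -(subee fb) addeA [X in (X - _)%E]ab0 add0e.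
Qed.

End weak_gradient_facts.

(** * Averages against a moving bump *)

Section smear.
Context (R : realType) (n : nat).
Local Notation leb := (lebesgue_rV R n).
Implicit Types (Omega : set 'rV[R]_n) (w : 'rV[R]_n -> R) (p v c z : 'rV[R]_n).

Lemma flat_algebra_derive_bounded (f : 'rV[R]_n -> R) v : flat_algebra f ->
  exists2 C, 0 <= C & forall x, `|'D_v f x| <= C.
Proof.
move=> ff.
have /choice[C HC] i : exists C, forall x, `|partial i f x| <= C.
  exact/flat_algebra_bounded/flat_algebra_partial.
have C0 i : 0 <= C i by apply: le_trans (HC i 0).
exists (\sum_i `|v ord0 i| * C i); first by apply: sumr_ge0 => i _; rewrite mulr_ge0.
move=> x; rewrite derive_sum_partial; last exact: flat_algebra_differentiable.
apply: le_trans (ler_norm_sum _ _ _) _; apply: ler_sum => i _.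
by rewrite normrM ler_wpM2l.
Qed.

Lemma derive_shift_arg (f : 'rV[R]_n -> R) c v z :
  'D_v (fun z => f (z - c)) z = 'D_v f (z - c).
Proof.
have E : (fun h : R => h^-1 *: (((fun z => f (z - c)) \o shift z) (h *: v) - f (z - c))) =
    (fun h : R => h^-1 *: ((f \o shift (z - c)) (h *: v) - f (z - c))).
  by apply/funext => h /=; rewrite addrA.
by rewrite /derive E.
Qed.

Lemma derive_bumpE d c v z : 'D_v (bump d c) z = 'D_v (bump d 0) (z - c).
Proof.
by rewrite (_ : bump d c = fun z => bump d 0 (z - c)) ?derive_shift_arg//; apply/funext => y; exact: bump_shift.
Qed.

(** Moving the centre with velocity [v] amounts to moving the argument with
velocity [- v]. *)
Lemma is_derive_bump d p v z (t : R) :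
  is_derive t 1 (fun s : R => bump d (p + s *: v) z) ('D_(- v) (bump d (p + t *: v)) z).
Proof.
have E (s : R) : z - (p + s *: v) = (z - p) + s *: (- v).
  by rewrite scalerN opprD addrA.
rewrite derive_bumpE E.
rewrite (_ : (fun _ => _) = (fun s => bump d 0 ((z - p) + s *: (- v)))).
  by apply: is_derive_line; apply: flat_algebra_derivable; exact: flat_algebra_bump.
by apply/funext => s; rewrite bump_shift E.
Qed.

Lemma measurable_flat_algebra D (f : 'rV[R]_n -> R) : flat_algebra f ->
  measurable_fun D (f : 'rV[R]_n -> measurableTypeR R).
Proof.
move=> ff; apply: measurable_funTS; apply: continuous_measurable_rV.
exact: flat_algebra_continuous.
Qed.

Definition smear Omega w d c : R := \int[leb]_(z in Omega) (w z * bump d c z).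

Section bounded_weight.
Variables (Omega : set 'rV[R]_n) (w : 'rV[R]_n -> R) (C : R).
Hypotheses (mO : measurable Omega) (Ofin : (leb Omega < +oo)%E).
Hypotheses (mw : measurable_fun Omega (w : 'rV[R]_n -> measurableTypeR R)).
Hypothesis (wC : forall z, Omega z -> `|w z| <= C).

Lemma integrable_bounded_mul (f : 'rV[R]_n -> R) D :
  measurable_fun Omega (f : 'rV[R]_n -> measurableTypeR R) ->
  (forall z, `|f z| <= D) -> leb.-integrable Omega (EFin \o (fun z => w z * f z)).
Proof.
move=> mf fD; apply: measurable_bounded_integrable => //.
  exact: measurable_funM.
exists (C * D); split; first exact: num_real.
move=> N CN z Oz /=; apply: le_trans (ltW CN).
by rewrite normrM ler_pM// wC.
Qed.

Lemma integrable_bump d c : leb.-integrable Omega (EFin \o (fun z => w z * bump d c z)).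
Proof.
have [D HD] := flat_algebra_bounded (flat_algebra_bump d c).
apply: (integrable_bounded_mul _ HD).
by apply: measurable_flat_algebra; exact: flat_algebra_bump.
Qed.

(** Differentiation under the integral sign, the derivative of the bump being
bounded uniformly in the position of its centre. *)
Lemma is_derive_smear d p v (t : R) :
  is_derive t 1 (fun s : R => smear Omega w d (p + s *: v))
    (\int[leb]_(z in Omega) (w z * 'D_(- v) (bump d (p + t *: v)) z)).
Proof.
have [D D0 HD] := flat_algebra_derive_bounded (- v) (flat_algebra_bump d (0 : 'rV[R]_n)).
pose f (s : R) z := w z * bump d (p + s *: v) z.
have fd z s : is_derive s (1 : R) (f ^~ z) (w z * 'D_(- v) (bump d (p + s *: v)) z).
  exact: (is_deriveZ (w z) (is_derive_bump d p v z s)).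
have It : `]t - 1, t + 1[%classic t by rewrite /= in_itv/= ltrDl gtrBl ltr01.
have intf s : `]t - 1, t + 1[%classic s -> leb.-integrable Omega (EFin \o f s).
  by move=> _; exact: integrable_bump.
have derf s z : `]t - 1, t + 1[%classic s -> Omega z -> derivable (f ^~ z) s 1.
  by move=> _ _; have [] := fd z s.
have C0 : 0 <= `|C| * D by rewrite mulr_ge0.
have intG : leb.-integrable Omega (EFin \o (cst (`|C| * D) : 'rV[R]_n -> R)).
  apply: measurable_bounded_integrable => //; exists (`|C| * D); split.
    exact: num_real.
  by move=> N CN z _ /=; rewrite ger0_norm// ltW.
have G_ub s z : `]t - 1, t + 1[%classic s -> Omega z ->
    `|partial1of2 f s z| <= cst (`|C| * D) z.
  move=> _ Oz; rewrite partial1of2E; have [_ ->] := fd z s.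
  rewrite normrM derive_bumpE /= ler_pM// (le_trans (wC Oz))// ler_norm.
  by [].
split.
  exact: (derivable_under_integral mO It intf derf (G := cst (`|C| * D))).
have := differentiation_under_integral mO It intf derf (G := cst (`|C| * D))
  (fun=> C0) intG G_ub.
rewrite derive1E => ->; apply: eq_Rintegral => z _.
by rewrite partial1of2E; have [_ ->] := fd z t.
Qed.

End bounded_weight.

End smear.

(** * A bounded weak gradient gives a Lipschitz bound *)

Section lipschitz.
Context (R : realType) (n : nat).
Local Notation leb := (lebesgue_rV R n).
Implicit Types (Omega : set 'rV[R]_n) (p v c z : 'rV[R]_n).

Lemma ae_bounded_integrable Omega (f : 'rV[R]_n -> R) M :
  measurable Omega -> (leb Omega < +oo)%E ->
  measurable_fun Omega (f : 'rV[R]_n -> measurableTypeR R) ->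
  {ae leb, forall z, Omega z -> `|f z| <= M} -> leb.-integrable Omega (EFin \o f).
Proof.
move=> mO Ofin mf fM; apply/integrableP; split; first exact/measurable_EFinP.
have mf' : measurable_fun Omega (fun z => `|(f z)%:E|%E).
  by apply: measurableT_comp => //; exact/measurable_EFinP.
apply: (@le_lt_trans _ _ (\int[leb]_(z in Omega) (`|M|%:E))%E).
  apply: ae_ge0_le_integral => //.
  apply: filterS fM => z fM Oz; rewrite /= lee_fin (le_trans (fM Oz))//.
  exact: ler_norm.
rewrite integral_cst//; apply: lte_mul_pinfty => //.
Qed.

Lemma ae_normr_le_Rintegral Omega (f h : 'rV[R]_n -> R) : measurable Omega ->
  leb.-integrable Omega (EFin \o f) -> leb.-integrable Omega (EFin \o h) ->
  {ae leb, forall z, Omega z -> `|f z| <= h z} -> (forall z, 0 <= h z) ->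
  `|\int[leb]_(z in Omega) f z| <= \int[leb]_(z in Omega) h z.
Proof.
move=> mO If Ih fh h0; apply: (le_trans (le_normr_Rintegral mO If)).
have In : leb.-integrable Omega (EFin \o (fun z => `|f z|)).
  exact: (integrable_abse If).
apply: fine_le; [exact: integrable_fin_num|exact: integrable_fin_num|].
have /integrableP[m1 _] := In; have /integrableP[m2 _] := Ih.
apply: ae_ge0_le_integral => //.
- by move=> z _; rewrite lee_fin.
Qed.

Lemma integrable_Rsum Omega I (r : seq I) (F : I -> 'rV[R]_n -> R) :
  measurable Omega -> (forall i, leb.-integrable Omega (EFin \o F i)) ->
  leb.-integrable Omega (EFin \o (fun z => \sum_(i <- r) F i z)).
Proof.
move=> mO IF; rewrite (_ : _ \o _ = (fun z => \sum_(i <- r) (EFin \o F i) z)%E).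
  by apply: integrable_sum.
by apply/funext => z /=; rewrite sumEFin.
Qed.

Section smear_estimates.
Variables (Omega : set 'rV[R]_n) (u : 'rV[R]_n -> R) (g : 'rV[R]_n -> 'rV[R]_n).
Variables (C G : R).
Hypotheses (mO : measurable Omega) (Ofin : (leb Omega < +oo)%E).
Hypotheses (mu : measurable_fun Omega (u : 'rV[R]_n -> measurableTypeR R)).
Hypotheses (uC : forall z, Omega z -> `|u z| <= C).
Hypotheses (mg : measurable_fun Omega g).
Hypotheses (gG : {ae leb, forall z, Omega z -> enorm (g z) <= G}).
Hypothesis (wug : weak_gradient Omega u g).

Let m1 : measurable_fun Omega (cst 1 : 'rV[R]_n -> measurableTypeR R).
Proof. exact: measurable_cst. Qed.
Let c1 z : Omega z -> `|cst 1 z : R| <= 1. Proof. by rewrite normr1. Qed.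

Let mgi i : measurable_fun Omega ((fun z => g z ord0 i) : 'rV[R]_n -> measurableTypeR R).
Proof. exact: (measurableT_comp (measurable_coord i) mg). Qed.

Let Igi i d c : leb.-integrable Omega (EFin \o (fun z => g z ord0 i * bump d c z)).
Proof.
have [D HD] := flat_algebra_bounded (flat_algebra_bump d c).
apply: (@ae_bounded_integrable _ _ (G * D)) => //.
  apply: measurable_funM; first exact: mgi.
  by apply: measurable_flat_algebra; exact: flat_algebra_bump.
apply: filterS gG => z gz Oz; rewrite normrM ler_pM//.
by rewrite (le_trans (coord_le_enorm _ _))// gz.
Qed.

(** The derivative of the average along [v] only involves partial derivatives of
the bump, so the weak gradient can be substituted: it is the average of the
derivative of [u] along [v]. *)
Lemma smear_derive_weak d c v : 0 < d -> (forall z, `|z - c| <= d -> Omega z) ->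
  \int[leb]_(z in Omega) (u z * 'D_(- v) (bump d c) z) =
  \int[leb]_(z in Omega) \sum_i v ord0 i * (g z ord0 i * bump d c z).
Proof.
move=> d0 cO.
have ff := flat_algebra_bump d c.
have Iu i : leb.-integrable Omega (EFin \o (fun z => u z * partial i (bump d c) z)).
  have [D HD] := flat_algebra_bounded (flat_algebra_partial i ff).
  apply: (integrable_bounded_mul mO Ofin mu uC _ HD).
  by apply: measurable_flat_algebra; exact: flat_algebra_partial.
have IZ (a : 'I_n -> R) (F : 'I_n -> 'rV[R]_n -> R) :
    (forall i, leb.-integrable Omega (EFin \o F i)) ->
    forall i, leb.-integrable Omega (EFin \o (fun z => a i * F i z)).
  by move=> IF i; apply: (integrableZl mO (a i) (IF i)).
transitivity (\int[leb]_(z in Omega) \sum_i (- v ord0 i) * (u z * partial i (bump d c) z)).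
  apply: eq_Rintegral => z _.
  rewrite derive_sum_partial; last exact: flat_algebra_differentiable.
  by rewrite mulr_sumr; apply: eq_bigr => i _; rewrite mxE; ring.
rewrite Rintegral_sum//; last exact: (IZ (fun i => - v ord0 i)).
rewrite Rintegral_sum//; last exact: (IZ (fun i => v ord0 i)).
apply: eq_bigr => i _.
rewrite !RintegralZl//.
rewrite /Rintegral (wug (bump_test_function d0 cO)) fineN.
by rewrite mulrN mulNr opprK.
Qed.

Lemma smear_derive_le d c v : 0 < d -> (forall z, `|z - c| <= d -> Omega z) ->
  0 <= G ->
  `|\int[leb]_(z in Omega) (u z * 'D_(- v) (bump d c) z)| <=
  G * enorm v * smear Omega (cst 1) d c.
Proof.
move=> d0 cO G0; rewrite smear_derive_weak// /smear.
rewrite -RintegralZl//; last exact: (integrable_bump mO Ofin m1 c1).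
apply: ae_normr_le_Rintegral => //.
- apply: integrable_Rsum => //.
  by move=> i; exact: (integrableZl mO (v ord0 i) (Igi i d c)).
- exact: (integrableZl mO (G * enorm v) (integrable_bump mO Ofin m1 c1 d c)).
- apply: filterS gG => z gz Oz.
  rewrite mul1r; under eq_bigr do rewrite mulrA.
  rewrite -mulr_suml normrM (ger0_norm (bump_ge0 _ _ _)) ler_wpM2r ?bump_ge0//.
  rewrite (le_trans (dot_le_enorm v (g z)))// mulrC ler_wpM2r ?enorm_ge0//.
  exact: gz.
- by move=> z; rewrite mul1r !mulr_ge0 ?enorm_ge0 ?bump_ge0.
Qed.

End smear_estimates.

(** The mass of the bump is its average against the constant [1], whose gradient
is [0]: the preceding estimate with [G = 0] shows that it does not change. *)
Lemma smear1_const Omega d p v (t : R) : measurable Omega -> (leb Omega < +oo)%E ->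
  0 < d -> (forall s : R, 0 <= s <= 1 -> forall z, `|z - (p + s *: v)| <= d -> Omega z) ->
  0 <= t <= 1 -> smear Omega (cst 1) d (p + t *: v) = smear Omega (cst 1) d p.
Proof.
move=> mO Ofin d0 pO /andP[t0 t1].
have m1 : measurable_fun Omega (cst 1 : 'rV[R]_n -> measurableTypeR R) by exact: measurable_cst.
have c1 z : Omega z -> `|cst 1 z : R| <= 1 by rewrite normr1.
have w1 : weak_gradient Omega (cst 1) (cst 0).
  have := @weak_gradient_C1 R n Omega (cst 1) mO.
  rewrite (_ : (fun _ => _) = cst 0).
    apply.
    - exact: cst_continuous.
    - by move=> i x; exact: derivable_cst.
    - move=> i; rewrite (_ : partial _ _ = cst 0); first exact: cst_continuous.
      by apply/funext => x; rewrite /partial derive_cst.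
  by apply/funext => x; apply/rowP => i; rewrite !mxE /partial derive_cst.
have g0 : {ae leb, forall z, Omega z -> enorm (cst (0 : 'rV[R]_n) z) <= 0}.
  by apply/aeW => z _; rewrite /= enorm0.
have D s := is_derive_smear mO Ofin m1 c1 d p v s.
have [s] := MVT_segment t0 (fun s _ => D s)
  (derivable_within_continuous (fun s _ => @ex_derive _ _ _ _ _ _ _ (D s))).
rewrite in_itv/= => /andP[s0 st].
rewrite scale0r addr0 => E; apply/eqP; rewrite -subr_eq0 E mulf_eq0; apply/orP; left.
have s01 : 0 <= s <= 1 by rewrite s0 (le_trans st).
have := smear_derive_le mO Ofin m1 c1 (measurable_cst _) g0 w1 v d0 (pO s s01) (lexx 0).
by rewrite mul0r mul0r normr_le0.
Qed.

Lemma smear1_gt0 Omega d c : measurable Omega -> (leb Omega < +oo)%E ->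
  0 < d -> (forall z, `|z - c| <= d -> Omega z) -> 0 < smear Omega (cst 1) d c.
Proof.
move=> mO Ofin d0 cO.
have m1 : measurable_fun Omega (cst 1 : 'rV[R]_n -> measurableTypeR R) by exact: measurable_cst.
have c1 z : Omega z -> `|cst 1 z : R| <= 1 by rewrite normr1.
have Ib := integrable_bump mO Ofin m1 c1 d c.
rewrite lt_neqAle; apply/andP; split; last first.
  by apply: Rintegral_ge0 => z _; rewrite mul1r bump_ge0.
apply/negP => /eqP b0.
have /integrableP[mb _] := Ib.
have : (\int[leb]_(z in Omega) `|(cst (1 : R) z * bump d c z)%:E| = 0)%E.
  rewrite -[RHS]/(0%:E) b0 /smear /Rintegral fineK; last exact: integrable_fin_num.
  apply: eq_integral => z _; rewrite gee0_abs//= mul1r lee_fin.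
  exact: bump_ge0.
move/(ae_eq_integral_abs _ mO mb) => [N [mN N0 HN]].
have : (0 < leb (cube c d))%E by rewrite lebesgue_cube// lte_fin exprn_gt0// mulr_gt0.
apply/negP; rewrite -leNgt -[leRHS]N0; apply: le_measure; rewrite ?inE//.
  exact: measurable_cube.
move=> z cz; apply: HN => /= /(_ (cO _ (ltW cz))) [] /eqP.
by rewrite mul1r gt_eqF// bump_gt0.
Qed.

Lemma smear_approx Omega (u : 'rV[R]_n -> R) C d c e : measurable Omega ->
  (leb Omega < +oo)%E ->
  measurable_fun Omega (u : 'rV[R]_n -> measurableTypeR R) ->
  (forall z, Omega z -> `|u z| <= C) -> 0 < d -> 0 <= e ->
  (forall z, `|z - c| <= d -> `|u z - u c| <= e) ->
  `|smear Omega u d c - u c * smear Omega (cst 1) d c| <= e * smear Omega (cst 1) d c.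
Proof.
move=> mO Ofin mu uC d0 e0 ue.
have m1 : measurable_fun Omega (cst 1 : 'rV[R]_n -> measurableTypeR R) by exact: measurable_cst.
have c1 z : Omega z -> `|cst 1 z : R| <= 1 by rewrite normr1.
have I1 := integrable_bump mO Ofin m1 c1 d c.
have Iu := integrable_bump mO Ofin mu uC d c.
have IZ a := integrableZl mO a I1.
rewrite /smear -!RintegralZl// -RintegralB//; last exact: IZ.
apply: ae_normr_le_Rintegral => //.
- exact: (integrableB mO Iu (IZ (u c))).
- exact: IZ.
- apply/aeW => z Oz; rewrite mul1r -mulrBl normrM (ger0_norm (bump_ge0 _ _ _)).
  have [->|/(bump_neq0 d0)/ltW/ue zc] := eqVneq (bump d c z) 0; first by rewrite !mulr0.
  by rewrite ler_wpM2r// bump_ge0.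
- by move=> z; rewrite mul1r mulr_ge0// bump_ge0.
Qed.

(** Compactness of the segment gives a single cube size that fits inside the
domain all along it. *)
Lemma segment_margin Omega p v : open Omega ->
  (forall t : R, 0 <= t <= 1 -> Omega (p + t *: v)) ->
  \forall d \near (0 : R)^'+, forall t : R, 0 <= t <= 1 ->
    forall z, `|z - (p + t *: v)| <= d -> Omega z.
Proof.
move=> oO pO.
have /compact_near_coveringP cov := @segment_compact R 0 1.
pose P (d t : R) := forall z, `|z - (p + t *: v)| <= d -> Omega z.
suff H (t : R) : `[0, 1]%classic t -> \forall t' \near t & d \near (0 : R)^'+, P d t'.
  apply: filterS (cov R (0 : R)^'+ P _ H) => d Hd t t01.
  by apply: Hd; rewrite /= in_itv.
rewrite /= in_itv/= => t01.
have /nbhs_ballP[r /= r0 rO] : nbhs (p + t *: v) Omega.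
  by apply: open_nbhs_nbhs; split => //; exact: pO.
have r2 : 0 < r / 2 by rewrite divr_gt0.
near=> t' d.
have d2 : d < r / 2 by near: d; exact: nbhs_right_lt.
have t2 : `|p + t *: v - (p + t' *: v)| < r / 2.
  near: t'; have := @continuous_line R n p v t.
  by move=> /(@cvgr_dist_lt _ _ _ (nbhs t)); apply.
move=> z /= zd; apply: rO; rewrite -ball_normE /ball_/=.
rewrite -(subrKA (p + t' *: v)) (le_lt_trans (ler_normD _ _))// (splitr r) ltrD//.
by rewrite distrC (le_lt_trans zd).
Unshelve. all: end_near. Qed.

(** By the mean value theorem the average of [u] against the moving bump changes
by at most [G |v|] times the mass of the bump between the two ends, and at each
end it differs from the value of [u] times that mass by as little as desired,
[u] being continuous. *)
Lemma weak_gradient_lipschitz Omega u g p v : open Omega -> bounded_set Omega ->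
  W1oo Omega u g -> continuous u ->
  (forall t : R, 0 <= t <= 1 -> Omega (p + t *: v)) ->
  `|u (p + v) - u p| <= fine (Linf Omega (fun x => enorm (g x))) * enorm v.
Proof.
move=> oO bO [mu mg fu fg wug] cu pO.
set G := fine _.
have G0 : 0 <= G by rewrite fine_ge0// Linf_ge0.
have mO := open_measurable_rV oO.
have Ofin := bounded_lebesgue_fin mO bO.
have uC z : Omega z -> `|u z| <= fine (Linf Omega u) by exact: normr_le_Linf.
have gG : {ae leb, forall z, Omega z -> enorm (g z) <= G}.
  apply: filterS (Linf_ae fg) => z gz Oz.
  by apply: le_trans (gz Oz); rewrite ler_norm.
apply/ler_addgt0Pr => e e0.
have e20 : 0 < e / 2 by rewrite divr_gt0.
have osc c : \forall d \near (0 : R)^'+, forall z, `|z - c| <= d -> `|u z - u c| <= e / 2.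
  have /(@cvgrPdist_le _ _ _ (nbhs c)) /(_ _ e20) := cu c.
  move=> /nbhs_ballP[r /= r0 rH].
  near=> d => z zd; rewrite distrC; apply: rH; rewrite -ball_normE /ball_/= distrC.
  by apply: le_lt_trans zd _; near: d; exact: nbhs_right_lt.
have [d [d0 pd osc0 osc1]] : exists d : R, [/\ 0 < d,
    forall t : R, 0 <= t <= 1 -> forall z, `|z - (p + t *: v)| <= d -> Omega z,
    forall z, `|z - p| <= d -> `|u z - u p| <= e / 2 &
    forall z, `|z - (p + v)| <= d -> `|u z - u (p + v)| <= e / 2].
  near (0 : R)^'+ => d; exists d; split.
  - by near: d; exact: nbhs_right_gt.
  - by near: d; exact: segment_margin.
  - by near: d; exact: osc.
  - by near: d; exact: osc.
set m := smear Omega (cst 1) d p.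
have p0 z : `|z - p| <= d -> Omega z.
  by move=> zp; apply: (pd 0); rewrite ?lexx ?ler01// scale0r addr0.
have m0 : 0 < m by exact: smear1_gt0.
have mv : smear Omega (cst 1) d (p + v) = m.
  have := smear1_const mO Ofin d0 pd (t := 1).
  by rewrite scale1r lexx ler01; apply.
have a0 := smear_approx mO Ofin mu uC d0 (ltW e20) osc0.
have a1 := smear_approx mO Ofin mu uC d0 (ltW e20) osc1.
have lip : `|smear Omega u d (p + v) - smear Omega u d p| <= G * enorm v * m.
  have D s := is_derive_smear mO Ofin mu uC d p v s.
  have [s] := MVT_segment ler01 (fun s _ => D s)
    (derivable_within_continuous (fun s _ => @ex_derive _ _ _ _ _ _ _ (D s))).
  rewrite in_itv/= scale1r scale0r addr0 subr0 mulr1 => s01 ->.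
  rewrite /m -(smear1_const mO Ofin d0 pd s01).
  exact: (smear_derive_le mO Ofin mu uC mg gG wug v d0 (pd s s01) G0).
rewrite mv in a1.
rewrite -(ler_pM2r m0) -[in leLHS](gtr0_norm m0) -normrM.
set A := smear Omega u d (p + v) in a1 lip; set B := smear Omega u d p in a0 lip.
rewrite -/m in a0 a1.
have -> : (u (p + v) - u p) * m = (A - B) - ((A - u (p + v) * m) - (B - u p * m)) by ring.
apply: (le_trans (ler_normB _ _)); apply: le_trans (lerD lip (ler_normB _ _)) _.
apply: le_trans (lerD (lexx _) (lerD a1 a0)) _.
by rewrite mulrDl lerD2l -mulrDl -splitr.
Unshelve. all: end_near. Qed.

End lipschitz.

(** * Segments, boundary and inradius *)

Section geometry.
Context (R : realType) (n : nat).
Implicit Types (Omega : set 'rV[R]_n) (x y v : 'rV[R]_n).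

(** The exit time is the least [t] such that the point at time [t] lies outside. *)
Lemma first_exit Omega x y : open Omega -> Omega x -> ~ Omega y ->
  exists T : R, [/\ 0 < T <= 1,
    forall t, 0 <= t < T -> Omega (x + t *: (y - x)),
    ~ Omega (x + T *: (y - x)) & bd Omega (x + T *: (y - x))].
Proof.
move=> oO Ox Oy; set v := y - x.
pose A := [set t : R | 0 <= t /\ ~ Omega (x + t *: v)].
have A1 : A 1 by split=> //; rewrite scale1r /v addrC subrK.
have lA : lbound A 0 by move=> t [].
have hA : has_inf A by split; [exists 1|exists 0].
pose T := inf A.
have T0 : 0 <= T by apply: lb_le_inf => //; exists 1.
have T1 : T <= 1 by apply: ge_inf => //; exists 0.
have before t : 0 <= t < T -> Omega (x + t *: v).
  move=> /andP[t0 tT]; apply: contrapT => Ot.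
  have : T <= t by apply: ge_inf; [exists 0|].
  by rewrite leNgt tT.
have nT : ~ Omega (x + T *: v).
  move=> OT.
  have : \forall t \near T, Omega (x + t *: v).
    exact: (@continuous_line R n x v T _ (open_nbhs_nbhs (conj oO OT))).
  move=> /nbhs_ballP[r /= r0 rO].
  have [a [a0 Oa] aT] := inf_adherent r0 hA.
  have Ta : T <= a by apply: ge_inf; [exists 0|split].
  apply: Oa; apply: rO; rewrite /ball/= distrC.
  by rewrite ger0_norm ?subr_ge0// ltrBlDl.
have Tpos : 0 < T.
  rewrite lt_neqAle T0 andbT; apply/eqP => T00.
  by apply: nT; rewrite -T00 scale0r addr0.
exists T; split => //; first by rewrite Tpos.
split; last by move=> /interior_subset.
move=> B /(@continuous_line R n x v T) BT.
have BT0 : \forall t \near T, B (x + t *: v) := BT.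
have BT' : \forall t \near T^'-, B (x + t *: v) by exact: cvg_within BT0.
near T^'- => t; exists (x + t *: v); split.
  apply: before; apply/andP; split.
    by near: t; exact: nbhs_left_ge.
  by near: t; exact: nbhs_left_lt.
by near: t.
Unshelve. all: end_near. Qed.

Lemma bd_notin Omega y : open Omega -> bd Omega y -> ~ Omega y.
Proof. by move=> oO [_ Oy] Oy'; apply: Oy; exact: open_nbhs_nbhs. Qed.

Lemma edist_to_le (A : set 'rV[R]_n) x y : A y -> edist_to A x <= enorm (x - y).
Proof.
move=> Ay; apply: ge_inf; last by exists y.
by exists 0 => _ [z _ <-]; exact: enorm_ge0.
Qed.

Lemma edist_to_lt (A : set 'rV[R]_n) x r : A !=set0 -> edist_to A x < r ->
  exists2 y, A y & enorm (x - y) < r.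
Proof.
move=> [y0 Ay0] H.
have hA : has_inf [set enorm (x - y) | y in A].
  by split; [exists (enorm (x - y0)); exists y0|exists 0 => _ [z _ <-]; exact: enorm_ge0].
have r0 : 0 < r - edist_to A x by rewrite subr_gt0.
have [_ [y Ay <-]] := inf_adherent r0 hA.
by rewrite -/(edist_to A x) subrKC => H'; exists y.
Qed.

End geometry.

Section inradius.
Context (R : realType) (n : nat).
Implicit Types (Omega : set 'rV[R]_n.+1) (x y : 'rV[R]_n.+1).

Lemma bd_nonempty Omega : open Omega -> bounded_set Omega -> Omega !=set0 ->
  bd Omega !=set0.
Proof.
move=> oO [M [_ HM]] [x Ox].
pose y : 'rV[R]_n.+1 := const_mx (`|M| + 2).
have Oy : ~ Omega y.
  have MM : M < `|M| + 1 by rewrite (le_lt_trans (ler_norm _))// ltrDl.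
  move=> /(HM _ MM) /= /(le_trans (coord_le_norm y ord0)).
  rewrite mxE ger0_norm ?addr_ge0// lerD2l.
  by rewrite leNgt ltr1n.
have [T [_ _ _ bT]] := first_exit oO Ox Oy.
by eexists; exact: bT.
Qed.

Lemma has_sup_edist Omega : open Omega -> bounded_set Omega -> Omega !=set0 ->
  has_sup [set edist_to (bd Omega) x | x in closure Omega].
Proof.
move=> oO bO O0; have [y0 by0] := bd_nonempty oO bO O0.
split.
  by have [x Ox] := O0; exists (edist_to (bd Omega) x); exists x => //; exact: subset_closure.
have [M [_ HM]] := bO.
have MM : M < `|M| + 1 by rewrite (le_lt_trans (ler_norm _))// ltrDl.
have cM x : closure Omega x -> `|x| <= `|M| + 1.
  have cB : closed (closed_ball (0 : 'rV[R]_n.+1) (`|M| + 1)) by exact: closed_ball_closed.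
  have : Omega `<=` closed_ball (0 : 'rV[R]_n.+1) (`|M| + 1).
    move=> z Oz; rewrite closed_ballE ?ltr_wpDl// /closed_ball_/= sub0r normrN.
    exact: HM.
  move=> /closure_subset /[apply]; rewrite -(proj1 (closure_id _) cB).
  by rewrite closed_ballE ?ltr_wpDl// /closed_ball_/= sub0r normrN.
exists (n.+1%:R * (`|M| + 1 + `|y0|)) => _ [x Ox <-].
apply: (le_trans (edist_to_le x by0)); apply: (le_trans (enorm_le_norm _)).
by rewrite ler_wpM2l// (le_trans (ler_normB _ _))// lerD2r cM.
Qed.

Lemma edist_le_inradius Omega x : open Omega -> bounded_set Omega -> Omega x ->
  edist_to (bd Omega) x <= inradius Omega.
Proof.
move=> oO bO Ox; apply: ub_le_sup.
  by have [] := has_sup_edist oO bO (ex_intro _ x Ox).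
by exists x => //; exact: subset_closure.
Qed.

(** The centre is a point that almost realizes the inradius. A point of the ball
outside [Omega] would produce, on the segment to the centre, a boundary point
that is too close. *)
Lemma inscribed_ball Omega r : open Omega -> bounded_set Omega -> Omega !=set0 ->
  0 < r < inradius Omega ->
  exists2 x0, Omega x0 & forall x, enorm (x - x0) < r -> Omega x.
Proof.
move=> oO bO O0 /andP[r0 rR].
have e0 : 0 < inradius Omega - r by rewrite subr_gt0.
have [_ [x0 cx0 <-]] := sup_adherent e0 (has_sup_edist oO bO O0).
rewrite -/(inradius Omega) subKr => rx.
have Ox0 : Omega x0.
  apply: contrapT => nOx0.
  have : edist_to (bd Omega) x0 <= enorm (x0 - x0).
    by apply: edist_to_le; split => // /interior_subset.
  by rewrite subrr enorm0 leNgt (lt_trans r0).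
exists x0 => // x xr; apply: contrapT => nOx.
have [T [/andP[T0 T1] _ _ bT]] := first_exit oO Ox0 nOx.
have := edist_to_le x0 bT; rewrite leNgt => /negP; apply.
rewrite opprD addNKr enormN enormZ ger0_norm; last exact: ltW.
apply: le_lt_trans rx; apply: le_trans (ltW xr).
by rewrite -[leRHS]mul1r ler_wpM2r// enorm_ge0.
Qed.

End inradius.

(** * The lower bound *)

Section lower_bound.
Context (R : realType) (n : nat).
Variables (Omega : set 'rV[R]_n.+1) (J u : 'rV[R]_n.+1 -> R).
Variables (g : 'rV[R]_n.+1 -> 'rV[R]_n.+1).
Hypotheses (oO : open Omega) (bO : bounded_set Omega).
Hypothesis J_gt0 : forall x, enorm x < jump_radius J -> 0 < J x.
Hypothesis ug : W1oo0 Omega u g.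

Lemma W1oo0_normr_le x : `|u x| <= fine (Linf Omega u).
Proof.
have [[_ _ fu _ _] cu u0] := ug.
have [Ox|Ox] := pselect (Omega x); first exact: normr_le_Linf.
by rewrite u0// normr0 fine_ge0// Linf_ge0.
Qed.

Lemma jump_le x y : enorm (x - y) < jump_radius J ->
  `|u x - u y| <= jump_seminorm J u.
Proof.
move=> xy; apply: ub_le_sup; last first.
  exists x, y; split => //; apply: subset_closure => /=.
  by rewrite gt_eqF// J_gt0.
exists (fine (Linf Omega u) + fine (Linf Omega u)) => _ [a [c [_ ->]]].
by rewrite (le_trans (ler_normB _ _))// lerD// W1oo0_normr_le.
Qed.

Lemma jumps_le x v k : enorm v < jump_radius J ->
  `|u (x + k%:R *: v) - u x| <= k%:R * jump_seminorm J u.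
Proof.
move=> vJ; elim: k => [|k IH]; first by rewrite scale0r addr0 subrr normr0 mul0r.
rewrite -(subrKA (u (x + k%:R *: v))) (le_trans (ler_normD _ _))//.
rewrite mulrSr mulrDl mul1r addrC lerD// jump_le//.
by rewrite scalerDl scale1r addrA [x + _ + v]addrC addrK.
Qed.

(** The end of the segment may lie on the boundary: the Lipschitz bound passes
to the limit. *)
Lemma lipschitz_to_boundary p r :
  (forall t : R, 0 <= t < 1 -> Omega (p + t *: r)) ->
  `|u (p + r) - u p| <= fine (Linf Omega (fun x => enorm (g x))) * enorm r.
Proof.
move=> pr; have [W cu u0] := ug.
set G := fine _; have G0 : 0 <= G by rewrite fine_ge0// Linf_ge0.
apply/ler_addgt0Pr => e e0.
have cl : (fun t : R => u (p + t *: r)) t @[t --> (1 : R)] --> u (p + 1 *: r).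
  by apply: continuous_comp; [exact: continuous_line|exact: cu].
rewrite scale1r in cl.
have cl' : \forall t \near (1 : R), `|u (p + r) - u (p + t *: r)| <= e.
  by move/cvgrPdist_le : cl; apply.
have cl1 : \forall t \near (1 : R)^'-, `|u (p + r) - u (p + t *: r)| <= e.
  exact: cvg_within cl'.
near (1 : R)^'- => t.
have t0 : 0 <= t by near: t; exact: nbhs_left_ge.
have t1 : t < 1 by near: t; exact: nbhs_left_lt.
rewrite -(subrKA (u (p + t *: r))) (le_trans (ler_normD _ _))// addrC lerD//.
  apply: (le_trans (weak_gradient_lipschitz oO bO W cu _)).
    move=> s /andP[s0 s1]; rewrite scalerA; apply: pr.
    by rewrite mulr_ge0//= (le_lt_trans _ t1)// ler_piMl.
  rewrite enormZ ger0_norm// ler_wpM2l// ler_piMl ?enorm_ge0//.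
by near: t.
Unshelve. all: end_near. Qed.

(** The walk from [x] to the boundary, [K] jumps followed by a stretch along
which [u] is Lipschitz. *)
Lemma normr_le_jump_grad x (K : nat) b : Omega x -> (0 < K)%N -> 0 <= b ->
  0 < jump_radius J -> inradius Omega = K%:R * jump_radius J + b ->
  `|u x| <= K%:R * jump_seminorm J u +
            fine (Linf Omega (fun x => enorm (g x))) * b.
Proof.
move=> Ox K0 b0 J0 RO.
have [W cu u0] := ug.
set G := fine _; have G0 : 0 <= G by rewrite fine_ge0// Linf_ge0.
apply/ler_addgt0Pr => e e0.
(* G d <= e, so that a segment longer by d costs at most e. *)
pose d := e / (G + 1).
have G1 : 0 < G + 1 by rewrite ltr_wpDl.
have d0 : 0 < d by rewrite divr_gt0.
have Gd : G * d <= e.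
  by rewrite /d mulrCA ler_piMr ?(ltW e0)// ler_pdivrMr// mul1r lerDl.
have bd0 : bd Omega !=set0 by apply: bd_nonempty => //; exists x.
pose r := K%:R * jump_radius J + b + d.
have KJ0 : 0 < K%:R * jump_radius J by rewrite mulr_gt0// ltr0n.
have r0 : 0 < r by rewrite ltr_wpDl// addr_ge0// ltW.
have [y bdy xy] : exists2 y, bd Omega y & enorm (x - y) < r.
  apply: edist_to_lt => //.
  by rewrite (le_lt_trans (edist_le_inradius oO bO Ox))// RO ltrDl.
have [T [/andP[T0 T1] Tin Tout _]] := first_exit oO Ox (bd_notin oO bdy).
pose w := T *: (y - x).
have wr : enorm w < r.
  rewrite enormZ ger0_norm ?(ltW T0)//; apply: le_lt_trans xy.
  by rewrite -[in leRHS]opprB enormN ler_piMl// enorm_ge0.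
(* Scaled down from r to the jump radius, the exit vector is a jump, and K of
   them leave a length smaller than b + d. *)
pose v := (jump_radius J / r) *: w.
have vJ : enorm v < jump_radius J.
  rewrite enormZ ger0_norm ?divr_ge0 ?ltW// mulrAC ltr_pdivrMr//.
  by rewrite ltr_pM2l.
pose q := (1 - K%:R * jump_radius J / r) *: w.
have th1 : K%:R * jump_radius J / r < 1.
  by rewrite ltr_pdivrMr// mul1r /r -addrA ltrDl ltr_wpDl.
have th0 : 0 <= K%:R * jump_radius J / r by rewrite divr_ge0// ltW.
have E : x + K%:R *: v + q = x + w.
  by rewrite -addrA /v /q scalerA -scalerDl mulrA subrKC scale1r.
have uq : u (x + K%:R *: v + q) = 0 by apply: u0; rewrite E.
have H1 := jumps_le x K vJ.
have H2 : `|u (x + K%:R *: v + q) - u (x + K%:R *: v)| <= G * enorm q.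
  apply: lipschitz_to_boundary => t /andP[t0 t1].
  (* The stretch starts after the fraction th of the segment. *)
  pose th := K%:R * jump_radius J / r.
  have -> : x + K%:R *: v + t *: q = x + ((th + t * (1 - th)) * T) *: (y - x).
    rewrite /v /q /w !scalerA -addrA -scalerDl; congr (_ + _ *: _).
    by rewrite /th; ring.
  apply: Tin; rewrite -/th in th0 th1.
  have a1 : 0 <= th + t * (1 - th) by rewrite addr_ge0// mulr_ge0// subr_ge0 ltW.
  rewrite mulr_ge0 ?(ltW T0)//= -[ltRHS]mul1r ltr_pM2r//.
  by rewrite -[ltRHS](subrKC th) ltrD2l gtr_pMl// subr_gt0.
have Gq : G * enorm q <= G * b + e.
  apply: (@le_trans _ _ (G * (b + d))); last by rewrite mulrDr lerD2l.
  rewrite ler_wpM2l// enormZ ger0_norm ?subr_ge0 ?(ltW th1)//.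
  apply: (@le_trans _ _ ((1 - K%:R * jump_radius J / r) * r)).
    by rewrite ler_wpM2l ?(ltW wr)// subr_ge0 ltW.
  rewrite mulrBl mul1r mulfVK ?gt_eqF// lerBlDl /r addrA.
  by [].
rewrite uq sub0r normrN in H2.
rewrite -[u x](subKr (u (x + K%:R *: v))) (le_trans (ler_normB _ _))//.
by rewrite addrC -addrA lerD// (le_trans H2).
Qed.

End lower_bound.

(** * The climbing profile *)

Section staircase.
Context (R : realType).
Implicit Types (t s : R) (k : nat).

(** The staircase with [k] full steps of height [1], starting at the multiples
of [r], followed by a last one of height [b]. Written with minima and maxima of
functions of slope [0] or [1], it is Lipschitz with constant [1] by
construction. *)
Fixpoint stair (r b : R) k t : R :=
  if k is k'.+1 then Num.max (Num.min t 1) (1 + stair r b k' (t - r))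
  else Num.min t b.

Definition profile (r b : R) k t : R := Num.max 0 (stair r b k t).

Section stair_facts.
Variables (r b : R).
Hypotheses (r1 : 1 <= r) (b0 : 0 <= b) (b1 : b <= 1).

Lemma stair_le k t : stair r b k t <= t.
Proof.
elim: k t => [|k IH] t /=; first by rewrite ge_min lexx.
rewrite ge_max; apply/andP; split; first by rewrite ge_min lexx.
apply: (@le_trans _ _ (1 + (t - r))); first by rewrite lerD2l.
by rewrite addrCA gerDl subr_le0.
Qed.

Lemma stair_homo k : {homo stair r b k : t s / t <= s}.
Proof.
elim: k => [|k IH] t s ts /=; first exact: le_min2.
by apply: le_max2; [exact: le_min2|rewrite lerD2l IH// lerD2r].
Qed.

Lemma min_lip c t s : t <= s -> Num.min s c <= Num.min t c + (s - t).
Proof.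
move=> ts; rewrite -lerBlDr le_min !lerBlDr !ge_min.
by apply/andP; split; apply/orP; [left|right]; lra.
Qed.

Lemma max_le_add (x y x' y' d : R) : x <= x' + d -> y <= y' + d ->
  Num.max x y <= Num.max x' y' + d.
Proof.
move=> xd yd; rewrite ge_max; apply/andP; split.
  by apply: (le_trans xd); rewrite lerD2r le_max lexx.
by apply: (le_trans yd); rewrite lerD2r le_max lexx orbT.
Qed.

Lemma stair_lip k t s : t <= s -> stair r b k s <= stair r b k t + (s - t).
Proof.
elim: k t s => [|k IH] t s ts /=; first exact: min_lip.
apply: max_le_add; first exact: min_lip.
have H : t - r <= s - r by rewrite lerD2r.
by have {}IH := IH _ _ H; lra.
Qed.

(** A staircase with more steps is higher; comparing [k] steps with [k.+1] is
what a shift by [r] requires in the estimate of the jumps. *)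
Lemma stair_succ k t : stair r b k t <= stair r b k.+1 t.
Proof.
elim: k t => [|k IH] t; first by rewrite /= le_max le_min2.
rewrite [X in X <= _]/= [X in _ <= X]/=; apply: le_max2 => //.
by rewrite lerD2l; exact: IH.
Qed.

Lemma profile_jump k t : profile r b k (t + r) <= 1 + profile r b k t.
Proof.
rewrite /profile ge_max addr_ge0 ?le_max ?lexx//=.
case: k => [|k]; first by rewrite /= ge_min (le_trans b1) ?orbT// lerDl le_max lexx.
rewrite [X in X <= _]/= ge_max ge_min lerDl le_max lexx orbT/= addrK lerD2l.
by rewrite le_max stair_succ orbT.
Qed.

Lemma profile_ge k t : k%:R * r + b <= t -> k%:R + b <= profile r b k t.
Proof.
move=> kt; rewrite le_max; apply/orP; right; apply: le_trans (stair_homo k kt).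
elim: k {kt} => [|k IH]; first by rewrite /= mul0r !add0r minxx.
rewrite /= le_max; apply/orP; right.
have -> : k.+1%:R * r + b - r = k%:R * r + b by rewrite -natr1; ring.
by rewrite -natr1; lra.
Qed.

Lemma profile_le0 k t : t <= 0 -> profile r b k t = 0.
Proof. by move=> t0; apply/max_idPl; apply: le_trans t0; exact: stair_le. Qed.

Lemma profile_homo k : {homo profile r b k : t s / t <= s}.
Proof. by move=> t s ts; apply: le_max2 => //; exact: stair_homo. Qed.

Lemma profile_lip k t s : t <= s -> profile r b k s <= profile r b k t + (s - t).
Proof.
move=> ts; apply: max_le_add; first by rewrite add0r subr_ge0.
exact: stair_lip.
Qed.

Lemma profile_continuous k : continuous (profile r b k).
Proof.
move=> t; apply/cvgrPdist_le => e e0; near=> s.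
have H : `|profile r b k t - profile r b k s| <= `|t - s|.
  have [ts|st] := leP t s.
    rewrite distrC (distrC t) !ger0_norm ?subr_ge0//; last exact: profile_homo.
    by rewrite lerBlDl profile_lip.
  rewrite !ger0_norm ?subr_ge0 ?(ltW st)//; last by rewrite profile_homo// ltW.
  by rewrite lerBlDl profile_lip// ltW.
apply: (le_trans H); near: s.
exact: (@cvgr_dist_le _ _ _ (nbhs t) _ id t (@cvg_id _ (nbhs t)) e e0).
Unshelve. all: end_near. Qed.

End stair_facts.

(** Since [f] vanishes on the negative half-line, its integral over the whole of
]-oo, t] makes sense and is an antiderivative on the whole line. *)
Lemma antiderivative (f : R -> R) : continuous f -> (forall t, t <= 0 -> f t = 0) ->
  exists F : R -> R, forall t, is_derive t (1 : R) F (f t).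
Proof.
move=> cf f0.
have If u : (@lebesgue_measure R).-integrable [set` `]-oo, u]] (EFin \o f).
  have I0 : (@lebesgue_measure R).-integrable `[0, `|u|] (EFin \o f).
    apply: continuous_compact_integrable; first exact: segment_compact.
    exact: continuous_subspaceT.
  have : (@lebesgue_measure R).-integrable `]-oo, `|u|] (EFin \o f).
    apply/integrable_mkcond => //.
    move/integrable_mkcond : I0 => /(_ _); rewrite (_ : _ \_ _ = (EFin \o f) \_ `]-oo, `|u|]).
      by apply.
    apply/funext => t; rewrite /patch !mem_setE !in_itv/=.
    have [t0|t0] := leP 0 t => //=.
    by case: ifP => // _; rewrite /= f0// ltW.
  apply: integrableS => //; apply: subset_itvl; rewrite bnd_simp.
  exact: ler_norm.
exists (fun x => \int[@lebesgue_measure R]_(t in [set` `]-oo, x]]) f t) => t.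
have t1 : t < t + 1 by rewrite ltrDl.
have [D E] := @continuous_FTC1 R f -oo%O t (t + 1) t1 (If _) (ltNyr t) (cf t).
by apply: DeriveDef; [exact: D|rewrite -derive1E; exact: E].
Qed.

(** [P t] is the mean of the profile [f] over [t - e, t], written with an
antiderivative [I] of [f]. Then [P'] is a difference quotient of [f], which lies
in [0, 1], and [P t] is a value of [f] on that interval. Over a length [r] the
increments of [P] are means of those of [f], hence at most [1]. *)
Lemma smooth_profile (r b e : R) k : 1 <= r -> 0 <= b <= 1 -> 0 < e ->
  exists P dP : R -> R, [/\ forall t, is_derive t (1 : R) P (dP t), continuous dP,
    forall t, 0 <= dP t <= 1,
    forall t, t <= 0 -> P t = 0 &
    (forall t s, `|t - s| <= r -> `|P t - P s| <= 1) /\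
    (forall s, 0 <= s -> k%:R + b - s - e <= P (k%:R * r + b - s))].
Proof.
move=> r1 /andP[b0 b1] e0.
pose f := profile r b k.
have cf : continuous f by exact: profile_continuous.
have [I dI] := antiderivative cf (fun t => @profile_le0 r b r1 k t).
have cI t : {within `[t - e, t], continuous I}.
  by apply: derivable_within_continuous => s _; exact: ex_derive.
have te t : t - e <= t by rewrite gerBl ltW.
pose P t := (I t - I (t - e)) / e.
have mean t : exists2 c, t - e <= c <= t & P t = f c.
  have [c] := MVT_segment (te t) (fun s _ => dI s) (cI t).
  rewrite in_itv/= opprB subrKC => ct E; exists c => //.
  by rewrite /P E mulfK// gt_eqF.
have dsh (a t : R) : is_derive t (1 : R) (fun s => I (s + a)) (f (t + a)).
  have H : is_derive t (1 : R) (fun s : R => s + a) 1.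
    exact: is_derive_shift.
  by have := is_derive1_comp (g := fun s => s + a) (dI (t + a)) H; rewrite mulr1.
have dP t : is_derive t (1 : R) P ((f t - f (t - e)) / e).
  have := is_deriveZ e^-1 (is_deriveB (dI t) (dsh (- e) t)).
  rewrite [_ *: _]mulrC; congr is_derive.
  by apply/funext => s; rewrite /P /= [_ *: _]mulrC.
have cfe : continuous (fun s : R => f (s - e)).
  move=> s; apply: (@continuous_comp _ _ _ (fun s : R => s - e) f); last exact: cf.
  by apply: cvgB; [exact: cvg_id|exact: cvg_cst].
have P_homo t s : t <= s -> P t <= P s.
  move=> ts; have cP : {within `[t, s], continuous P}.
    by apply: derivable_within_continuous => x _; exact: ex_derive.
  have [c _ E] := MVT_segment ts (fun s _ => dP s) cP.
  rewrite -subr_ge0 E mulr_ge0 ?subr_ge0// divr_ge0 ?(ltW e0)// subr_ge0.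
  exact: profile_homo.
exists P, (fun t => (f t - f (t - e)) / e); split => //.
- move=> t; apply: cvgM; last exact: cvg_cst.
  by apply: cvgB; [exact: cf|exact: cfe].
- move=> t; apply/andP; split.
    by rewrite divr_ge0 ?(ltW e0)// subr_ge0 profile_homo.
  rewrite ler_pdivrMr// mul1r lerBlDl.
  by have := @profile_lip r b k _ _ (te t); rewrite opprB subrKC.
- move=> t t0; have [c /andP[_ ct] ->] := mean t.
  by apply: profile_le0 => //; exact: le_trans t0.
split.
- have jump t s : t <= s <= t + r -> P s - P t <= 1.
    move=> /andP[ts str].
    apply: (@le_trans _ _ (P (t + r) - P t)); first by rewrite lerD2r P_homo.
    (* The increment of I over a length r has derivative f (x + r) - f x <= 1. *)
    have dD x : is_derive x (1 : R) (fun y => I (y + r) - I y) (f (x + r) - f x).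
      exact: (is_deriveB (dsh r x) (dI x)).
    have cD : {within `[t - e, t], continuous (fun y => I (y + r) - I y)}.
      by apply: derivable_within_continuous => x _; exact: ex_derive.
    have [c _] := MVT_segment (te t) (fun s _ => dD s) cD.
    rewrite (_ : t - (t - e) = e) => [E|]; last by ring.
    rewrite /P -mulrBl ler_pdivrMr// mul1r.
    have -> : I (t + r) - I (t + r - e) - (I t - I (t - e)) = (f (c + r) - f c) * e.
      rewrite -E (_ : t + r - e = t - e + r); last by ring.
      by ring.
    rewrite ler_piMl ?(ltW e0)// lerBlDr.
    exact: profile_jump.
  move=> t s; wlog ts : t s / t <= s => [W H|].
    have [ts|/ltW st] := leP t s; first exact: W.
    by rewrite distrC; apply: W => //; rewrite distrC.
  rewrite distrC ger0_norm ?subr_ge0// => tsr.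
  rewrite distrC ger0_norm ?subr_ge0 ?P_homo//; apply: jump.
  by rewrite ts -lerBlDl.
- move=> s s0; set t := (X in P X); have [c /andP[tc ct] ->] := mean t.
  have H1 : f t <= f c + (t - c) by apply: profile_lip.
  have H2 : f (k%:R * r + b) <= f t + (k%:R * r + b - t).
    by apply: profile_lip; rewrite gerBl.
  have H3 : k%:R + b <= f (k%:R * r + b) by apply: profile_ge.
  have st : k%:R * r + b - t = s by rewrite /t; ring.
  by rewrite st in H2; lra.
Qed.

End staircase.

(** * Radial functions with a rounded tip *)

Section radial.
Context (R : realType) (n : nat).
Implicit Types (x y c v : 'rV[R]_n) (e : R).

(** The Euclidean distance between [(x, e)] and [(c, 0)] in one more
dimension. For [0 < e] it is smooth everywhere, including at [c], has slope at
most [1] and differs from [enorm (x - c)] by at most [e]. *)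
Definition softnorm e c x : R := Num.sqrt (enorm (x - c) ^+ 2 + e ^+ 2).

Lemma softnorm_sqr e c x : softnorm e c x ^+ 2 = enorm (x - c) ^+ 2 + e ^+ 2.
Proof. by rewrite sqr_sqrtr// addr_ge0// sqr_ge0. Qed.

Lemma softnorm_gt0 e c x : 0 < e -> 0 < softnorm e c x.
Proof. by move=> e0; rewrite sqrtr_gt0 ltr_wpDl ?sqr_ge0// exprn_gt0. Qed.

Lemma enorm_le_softnorm e c x : enorm (x - c) <= softnorm e c x.
Proof.
rewrite -[leLHS]ger0_norm ?enorm_ge0// -sqrtr_sqr ler_wsqrtr// lerDl.
exact: sqr_ge0.
Qed.

(** The difference of the squares of the two rounded norms is that of the squares
of the norms; factor both and compare the sums. *)
Lemma softnorm_lip e c x y : 0 < e ->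
  `|softnorm e c x - softnorm e c y| <= enorm (x - y).
Proof.
move=> e0; set A := softnorm e c x; set B := softnorm e c y.
have A0 : 0 < A by exact: softnorm_gt0.
have B0 : 0 < B by exact: softnorm_gt0.
set a := enorm (x - c); set d := enorm (y - c).
have aA : a <= A by exact: enorm_le_softnorm.
have cB : d <= B by exact: enorm_le_softnorm.
have a0 : 0 <= a by exact: enorm_ge0.
have d0 : 0 <= d by exact: enorm_ge0.
apply: (@le_trans _ _ `|a - d|); last first.
  by apply: le_trans (enorm_sub _ _) _; rewrite opprB addrA subrK.
have AB : 0 < A + B by rewrite addr_gt0.
rewrite -(ler_pM2r AB) -[in leLHS](gtr0_norm AB) -normrM -subr_sqr !softnorm_sqr.
rewrite opprD addrACA subrr addr0 subr_sqr normrM ler_wpM2l//.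
by rewrite ger0_norm ?addr_ge0// lerD.
Qed.

Lemma softnorm_continuous e c : continuous (softnorm e c).
Proof.
have H1 : continuous (fun z : 'rV[R]_n => enorm (z - c)).
  move=> z; apply: (@continuous_comp _ _ _ (fun z : 'rV[R]_n => z - c) (@enorm R n)).
    by apply: (@cvgB _ _ _ (nbhs z)); [exact: cvg_id|exact: cvg_cst].
  exact: enorm_continuous.
have H2 : continuous (fun z : 'rV[R]_n => enorm (z - c) ^+ 2 + e ^+ 2).
  move=> z; apply: (@cvgD _ _ _ (nbhs z)); last exact: cvg_cst.
  by apply: (@cvgM _ _ (nbhs z)); exact: H1.
by move=> z; apply: continuous_comp; [exact: H2|exact: sqrt_continuous].
Qed.

Lemma is_derive_of_line (f : 'rV[R]_n -> R) x v l :
  is_derive (0 : R) (1 : R) (fun t : R => f (x + t *: v)) l -> is_derive x v f l.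
Proof.
have E : (fun h : R => h^-1 *: ((f \o shift x) (h *: v) - f x)) =
    (fun h : R => h^-1 *:
      (((fun s : R => f (x + s *: v)) \o shift 0) (h *: (1 : R)) - f (x + 0 *: v))).
  apply/funext => h /=; congr (_ *: (f _ - f _)).
    by rewrite [_ *: 1]mulr1 addr0 addrC.
  by rewrite scale0r addr0.
by move=> [D V]; split; rewrite /derivable /derive E.
Qed.

(** Along a coordinate line the squared rounded norm is a quadratic polynomial,
so that its partial derivatives reduce to one-variable calculus. *)
Lemma softnorm_line e c x i (t : R) :
  softnorm e c (x + t *: delta_mx ord0 i) =
  Num.sqrt (softnorm e c x ^+ 2 + (2 * t * (x - c) ord0 i + t ^+ 2)).
Proof.
rewrite softnorm_sqr /softnorm; congr Num.sqrt; rewrite [RHS]addrAC; congr (_ + _).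
rewrite !enorm_sqr (bigD1 i)//= [in RHS](bigD1 i)//= [RHS]addrAC.
congr (_ + _); last first.
  apply: eq_bigr => j ji; rewrite !mxE eqxx/= [j == i]negbTE//.
  by rewrite mulr0 addr0.
by rewrite !mxE !eqxx/=; ring.
Qed.

Lemma is_derive_radial e c x i (P : R -> R) (r dP : R) : 0 < e ->
  is_derive (r - softnorm e c x) (1 : R) P dP ->
  is_derive x (delta_mx ord0 i) (fun z => P (r - softnorm e c z))
    (- dP / softnorm e c x * (x - c) ord0 i).
Proof.
move=> e0 HP; apply: is_derive_of_line.
set N := softnorm e c x in HP *; have N0 : 0 < N by exact: softnorm_gt0.
set a : R := (x - c) ord0 i.
under eq_fun do rewrite softnorm_line -/N -/a.
pose Q (t : R) := N ^+ 2 + (2 * t * a + t ^+ 2).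
have Q0 : Q 0 = N ^+ 2 by rewrite /Q; ring.
have dQ : is_derive (0 : R) (1 : R) Q (2 * a).
  pose p : {poly R} := (N ^+ 2)%:P + ((2 * a)%:P * 'X + 'X * 'X).
  have -> : Q = horner p.
    by apply/funext => t; rewrite /Q /p !(hornerD, hornerM, hornerC, hornerX); ring.
  apply: (is_derive_eq (is_derive_poly p 0)).
  rewrite /p !derivD !derivM !derivC !derivX !mul0r !mulr1 !mul1r !add0r.
  by rewrite !(hornerD, hornerM, hornerC, hornerX) !addr0.
have dS : is_derive (0 : R) (1 : R) (fun t => Num.sqrt (Q t)) (a / N).
  have N20 : 0 < Q 0 by rewrite Q0 exprn_gt0.
  apply: (is_derive_eq (is_derive1_comp (is_derive1_sqrt N20) dQ)).
  rewrite Q0 sqrtr_sqr gtr0_norm//; field.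
  by rewrite gt_eqF.
have dR : is_derive (0 : R) (1 : R) (fun t => r - Num.sqrt (Q t)) (- (a / N)).
  by apply: (is_derive_eq (is_deriveB (is_derive_cst r (0:R) (1:R)) dS)); rewrite sub0r.
have HP' : is_derive (r - Num.sqrt (Q 0)) (1 : R) P dP.
  by rewrite Q0 sqrtr_sqr gtr0_norm.
apply: (is_derive_eq (is_derive1_comp (g := fun t => r - Num.sqrt (Q t)) HP' dR)).
by rewrite mulrN mulNr mulNr mulrA mulrAC.
Qed.

End radial.

(** * The upper bound *)

Section upper_bound.
Context (R : realType) (n : nat).
Implicit Types (Omega : set 'rV[R]_n.+1) (J : 'rV[R]_n.+1 -> R).

Lemma enorm_supp_le J x : (exists r, forall x, ~ (enorm x < r) -> J x = 0) ->
  supp J x -> enorm x <= jump_radius J.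
Proof.
move=> [r0 Hr0]; pose D := [set y : 'rV[R]_n.+1 | enorm y <= jump_radius J].
have cD : closed D.
  rewrite (_ : D = @enorm R n.+1 @^-1` `]-oo, jump_radius J]).
    apply: closed_comp; last exact: interval_closed.
    by move=> y _; exact: enorm_continuous.
  by apply/seteqP; split => y; rewrite /D /= in_itv.
have E : D = closure D := (closure_id D).1 cD.
move=> sx; suff : D x by []; rewrite E; move: sx; apply: closure_subset.
move=> y /= Jy; apply: lb_le_inf; first by exists r0.
move=> r /= Hr; rewrite leNgt; apply/negP => yr; move/eqP: Jy; apply; apply: Hr.
by apply/negP; rewrite -leNgt ltW.
Qed.

(** The function [P (r - softnorm e x0 x)], with [P] the smoothed profile and [r]
the radius of the ball. Its gradient is at most [1] because the slopes of [P]
and of the rounded norm are; two points closer than the jump radius have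
rounded norms that are closer still, and the profile grows by at most [1] over
such a length. Each of the radius, the averaging and the rounding costs [e] at
the centre. *)
Lemma radial_competitor Omega J (K : nat) (b e : R) x0 :
  measurable Omega ->
  (exists r, forall x, ~ (enorm x < r) -> J x = 0) -> 0 < J 0 ->
  1 <= jump_radius J -> 0 <= b <= 1 -> 0 < e ->
  Omega x0 ->
  (forall x, enorm (x - x0) < K%:R * jump_radius J + b - e -> Omega x) ->
  exists u g, [/\ W1oo0 Omega u g,
    fine (Linf Omega (fun x => enorm (g x))) <= 1, jump_seminorm J u <= 1 &
    K%:R + b - 3 * e <= u x0].
Proof.
move=> mO hJ J0 RJ1 b01 e0 Ox0 ball.
set RJ := jump_radius J in RJ1 ball *.
have [P [dP [PdP cdP dP01 P0 [Pjump Ptop]]]] := smooth_profile K RJ1 b01 e0.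
set r := K%:R * RJ + b - e in ball.
pose N := softnorm e x0.
have N0 z : 0 < N z by exact: softnorm_gt0.
pose u z := P (r - N z).
pose g z : 'rV[R]_n.+1 := - dP (r - N z) / N z *: (z - x0).
have ui z i : is_derive z (delta_mx ord0 i) u (g z ord0 i).
  by rewrite mxE; exact: is_derive_radial.
have du i z : derivable u z (delta_mx ord0 i) by have [] := ui z i.
have pu i z : partial i u z = g z ord0 i by have [_] := ui z i.
have cP : continuous P.
  by move=> t; apply: differentiable_continuous; apply/derivable1_diffP; have [] := PdP t.
have cr : continuous (fun z => r - N z).
  move=> z; apply: (@cvgB _ _ _ (nbhs z)); first exact: cvg_cst.
  exact: softnorm_continuous.
have cu : continuous u by move=> z; apply: continuous_comp; [exact: cr|exact: cP].
have cdr : continuous (fun z => dP (r - N z)).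
  by move=> z; apply: continuous_comp; [exact: cr|exact: cdP].
have cg i : continuous (fun z => g z ord0 i).
  rewrite (_ : (fun _ => _) = (fun z => - dP (r - N z) / N z * (z ord0 i - x0 ord0 i))).
    move=> z; apply: (@cvgM _ _ (nbhs z)).
      apply: (@cvgM _ _ (nbhs z)); first by apply: (@cvgN _ _ _ (nbhs z)); exact: cdr.
      by apply: (@cvgV _ _ (nbhs z)); [rewrite gt_eqF|exact: softnorm_continuous].
    apply: (@cvgB _ _ _ (nbhs z)); last exact: cvg_cst.
    exact: coord_continuous.
  by apply/funext => z; rewrite !mxE.
have u0 z : ~ Omega z -> u z = 0.
  move=> Oz; apply: P0; rewrite subr_le0; apply: le_trans (enorm_le_softnorm e x0 z).
  by rewrite leNgt; apply/negP => /ball.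
have uM z : `|r| + `|x0| < `|z| -> u z = 0.
  move=> rz; apply: P0; rewrite subr_le0; apply: le_trans (enorm_le_softnorm e x0 z).
  apply: le_trans (norm_le_enorm _); apply: le_trans (ler_norm _) _.
  rewrite -(lerD2r `|x0|) (le_trans (ltW rz))//.
  by rewrite -[in leLHS](subrK x0 z) ler_normD.
have [C C0 uC] := continuous_compact_support_bounded cu uM.
have g1 z : Omega z -> `|enorm (g z)| <= 1.
  move=> _; rewrite ger0_norm ?enorm_ge0// enormZ normrM normrN normfV (gtr0_norm (N0 z)).
  have /andP[d0 d1] := dP01 (r - N z).
  rewrite ger0_norm// mulrAC ler_pdivrMr// mul1r.
  apply: le_trans (enorm_le_softnorm e x0 z).
  by rewrite ler_piMl// enorm_ge0.
exists u, g; split.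
- split => //; split.
  + exact: measurable_funTS (continuous_measurable_rV cu).
  + apply: measurable_funTS; apply: measurable_fun_rVP => i.
    exact: continuous_measurable_rV.
  + by rewrite (le_lt_trans (Linf_le C0 (fun z _ => uC z)))// ltry.
  + by rewrite (le_lt_trans (Linf_le ler01 g1))// ltry.
  + have := weak_gradient_C1 mO cu du; rewrite (_ : (fun _ => _) = g).
      apply => i; rewrite (_ : partial i u = fun z => g z ord0 i); first exact: cg.
      by apply/funext => z.
    by apply/funext => z; apply/rowP => i; rewrite mxE.
- exact: fine_Linf_le.
- apply: ge_sup.
    exists `|u 0 - u 0|; exists 0, 0; split => //.
    by rewrite subrr; apply: subset_closure => /=; rewrite gt_eqF.
  move=> _ [x [y [/(enorm_supp_le hJ) xy ->]]]; apply: Pjump.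
  have -> : r - N x - (r - N y) = N y - N x by ring.
  by rewrite distrC; apply: le_trans (softnorm_lip _ _ _ e0) xy.
- have -> : u x0 = P (K%:R * RJ + b - 2 * e).
    rewrite /u /N /softnorm subrr enorm0 expr0n/= add0r sqrtr_sqr gtr0_norm//.
    by congr P; rewrite /r; ring.
  have H2 : 0 <= 2 * e by rewrite mulr_ge0 ?ltW.
  by have := Ptop _ H2; lra.
Qed.

End upper_bound.

(** * The infimum of the quotients *)

Theorem theorem4p3 (R : realType) (n : nat) (alpha : R)
    (Omega : set 'rV[R]_n.+1) (J : 'rV[R]_n.+1 -> R) (K : nat) (b : R)
    (alpha01 : 0 < alpha <= 1)
    (Omega_nonempty : Omega !=set0) (Omega_open : open Omega)
    (Omega_connected : connected Omega) (Omega_bounded : bounded_set Omega)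
    (Omega_C1a : C1_holder_boundary alpha Omega)
    (J_radial : forall x y, enorm x = enorm y -> J x = J y)
    (J_ge0 : forall x, 0 <= J x) (J_continuous : continuous J)
    (J_compact_supp : compact (supp J)) (J0_gt0 : 0 < J 0)
    (J_mass1 : (\int[lebesgue_rV R n.+1]_x (J x)%:E = 1)%E)
    (J_gt0 : forall x, enorm x < jump_radius J -> 0 < J x)
    (b_range : 0 <= b < jump_radius J)
    (inradius_Kb : inradius Omega = K%:R * jump_radius J + b)
    (K_gt0 : (0 < K)%N) (b_gt0 : 0 < b) (RJ_gt1 : 1 < jump_radius J)
    (b_lt1 : b < 1) :
  Lambda Omega J = 1 / (K%:R + b).
Proof.
have RJ0 : 0 < jump_radius J by apply: lt_trans RJ_gt1.
have Kb0 : 0 < K%:R + b by rewrite ltr_wpDl.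
have hJ : exists r, forall x, ~ (enorm x < r) -> J x = 0.
  have [M [_ HM]] := compact_bounded J_compact_supp.
  exists (n.+1%:R * (`|M| + 1) + 1) => x /negP; rewrite -leNgt => Hx.
  apply/eqP/negPn/negP => Jx.
  have MM : M < `|M| + 1 by rewrite (le_lt_trans (ler_norm _))// ltrDl.
  have /(HM _ MM) /= xM : supp J x by exact: subset_closure.
  have := le_trans Hx (enorm_le_norm x).
  rewrite leNgt => /negP; apply; rewrite ltr_pwDr// ler_wpM2l//.
have mO := open_measurable_rV Omega_open.
set S := [set l | exists u g, [/\ W1oo0 Omega u g, exists x, u x != 0 &
    l = Num.max (fine (Linf Omega (fun x => enorm (g x)))) (jump_seminorm J u)
        / fine (Linf Omega u)]].
have lbS : lbound S (1 / (K%:R + b)).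
  move=> _ [u [g [ug [x ux] ->]]].
  have [[_ _ fu fg _] cu u0] := ug.
  set G := fine (Linf Omega (fun _ => _)); set j := jump_seminorm J u.
  have G0 : 0 <= G by rewrite fine_ge0// Linf_ge0.
  set M := Num.max G j.
  have M0 : 0 <= M by rewrite le_max G0.
  have Lpos : 0 < fine (Linf Omega u).
    by apply: lt_le_trans (W1oo0_normr_le Omega_open ug x); rewrite normr_gt0.
  have uM y : Omega y -> `|u y| <= M * (K%:R + b).
    move=> Oy; have := normr_le_jump_grad Omega_open Omega_bounded J_gt0 ug Oy
      K_gt0 (ltW b_gt0) RJ0 inradius_Kb.
    move=> /le_trans; apply; rewrite mulrDr [M * K%:R]mulrC lerD//.
      by rewrite ler_wpM2l// le_max lexx orbT.
    by rewrite ler_wpM2r ?(ltW b_gt0)// le_max lexx.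
  have LM : fine (Linf Omega u) <= M * (K%:R + b).
    by apply: fine_Linf_le => //; rewrite mulr_ge0// ltW.
  by rewrite ler_pdivrMr// mulrAC ler_pdivlMr// mul1r.
(* Competitors whose quotient is as close to the bound as desired; they also
   show that the set of quotients is not empty. *)
have upS e : 0 < e -> 3 * e < K%:R + b -> e < 1 ->
    exists2 l, S l & l <= 1 / (K%:R + b - 3 * e).
  move=> e0 e3 e1.
  have KR1 : 1 <= K%:R * jump_radius J.
    by rewrite -[leLHS]mulr1 ler_pM// ?ler1n// ltW.
  have [|x0 Ox0 ball] := @inscribed_ball _ _ _ (K%:R * jump_radius J + b - e)
      Omega_open Omega_bounded Omega_nonempty.
    by rewrite inradius_Kb gtrBl e0 andbT; lra.
  have b01 : 0 <= b <= 1 by rewrite !ltW.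
  have [u [g [ug G1 j1 ux0]]] := radial_competitor mO hJ J0_gt0 (ltW RJ_gt1) b01 e0 Ox0 ball.
  have c0 : 0 < K%:R + b - 3 * e by rewrite subr_gt0.
  have ux0' : u x0 != 0 by rewrite gt_eqF// (lt_le_trans c0).
  have L0 : K%:R + b - 3 * e <= fine (Linf Omega u).
    rewrite (le_trans ux0)// (le_trans (ler_norm _))//.
    exact: (W1oo0_normr_le Omega_open ug).
  eexists; first by exists u, g; split => //; exists x0.
  have Lp := lt_le_trans c0 L0.
  apply: ler_pM; rewrite ?invr_ge0 ?(ltW Lp)//.
  - by rewrite le_max fine_ge0// Linf_ge0.
  - by rewrite ge_max G1.
  - by rewrite lef_pV2.
have S0 : S !=set0.
  have c0 : 0 < Num.min ((K%:R + b) / 4) 2^-1 by rewrite lt_min divr_gt0//= invr_gt0.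
  have c4 : Num.min ((K%:R + b) / 4) 2^-1 <= (K%:R + b) / 4 by rewrite ge_min lexx.
  have c2 : Num.min ((K%:R + b) / 4) 2^-1 <= 2^-1 by rewrite ge_min lexx orbT.
  by have [||l Sl _] := upS _ c0; [lra|lra|exists l].
apply/eqP; rewrite eq_le; apply/andP; split; last exact: lb_le_inf.
rewrite -[Lambda Omega J]/(inf S).
rewrite ler_pdivlMr//; apply/ler_addgt0Pr => d d0.
have i0 : 0 <= inf S by apply: lb_le_inf => // l /lbS; apply: le_trans; rewrite divr_ge0// ltW.
(* The three bounds give 3 e inf S <= d, 3 e < K + b and e < 1. *)
pose e := Num.min (d / (3 * (inf S + 1))) (Num.min ((K%:R + b) / 4) 2^-1).
have e0 : 0 < e.
  rewrite !lt_min invr_gt0 ltr0n andbT; apply/andP; split; last exact: divr_gt0.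
  by apply: divr_gt0 => //; apply: mulr_gt0 => //; exact: ltr_wpDl.
have ed : e <= d / (3 * (inf S + 1)) by rewrite ge_min lexx.
have e4 : e <= (K%:R + b) / 4 by rewrite !ge_min lexx orbT.
have e2 : e <= 2^-1 by rewrite !ge_min lexx !orbT.
have [||l Sl lle] := upS e e0; [lra|lra|].
have : inf S <= 1 / (K%:R + b - 3 * e).
  by apply: le_trans lle; apply: ge_inf => //; exists (1 / (K%:R + b)).
have c0 : 0 < K%:R + b - 3 * e by lra.
rewrite ler_pdivlMr// => H.
have : inf S * (3 * e) <= d.
  apply: (@le_trans _ _ ((inf S + 1) * (3 * e))).
    by rewrite ler_wpM2r ?lerDl// mulr_ge0// ltW.
  rewrite mulrCA mulrA mulrC -ler_pdivlMr//.
  by rewrite mulr_gt0// ltr_wpDl.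
move: H; rewrite mulrBr; lra.
Qed.
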